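(* Let $p\in(0,1]$. Assume that there is no edge defect, in the sense that there exists a constant $\delta>0$ such that $|a(x)|\ge\delta$ for all $x\in\mathbf{Z}$. Suppose moreover that there exist constants $\rho,M>0$ such that $\|C(x)-C_0\|_\infty\le Me^{-\rho\langle x\rangle}$ for all $x\in\mathbf{Z}$. Then the continuous (i.e. essential) spectrum of $U$ is $\sigma_{ess}(U)=\{e^{i\theta} : \theta\in J_\gamma\}$, where $J_\gamma=J_{\gamma,1}\cup J_{\gamma,2}$ with $$J_{\gamma,1}=[\arccos p+\gamma/2,\ \pi-\arccos p+\gamma/2],\qquad J_{\gamma,2}=[\pi+\arccos p+\gamma/2,\ 2\pi-\arccos p+\gamma/2].$$ Moreover, $U$ has no eigenvalue in $\sigma_{ess}(U)\setminus\mathcal{T}$, where $\mathcal{T}=\{e^{i\theta}\in\sigma_{ess}(U) : \theta\in J_{\gamma,\mathcal{T}}\}$ with $$J_{\gamma,\mathcal{T}}=\{\arccos p+\gamma/2,\ \pi-\arccos p+\gamma/2,\ \pi+\arccos p+\gamma/2,\ 2\pi-\arccos p+\gamma/2\}.$$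
   Context: Let $\mathcal{H}=\ell^2(\mathbf{Z};\mathbf{C}^2)$, with elements $\psi(x)=(\psi^{(0)}(x),\psi^{(1)}(x))^T$. For each $x\in\mathbf{Z}$ let $C(x)=\begin{bmatrix} a(x)&b(x)\\ c(x)&d(x)\end{bmatrix}\in U(2)$, and let $C$ be the operator on $\mathcal{H}$ of multiplication by $C(x)$. The shift $S$ is $(S\psi)(x)=(\psi^{(0)}(x+1),\psi^{(1)}(x-1))^T$, and $U=SC$ is a unitary operator on $\mathcal{H}$. The constant coin is $$C_0=\begin{bmatrix} pe^{i\alpha} & qe^{i\beta}\\ -qe^{-i(\beta-\gamma)} & pe^{-i(\alpha-\gamma)}\end{bmatrix},\qquad \alpha,\beta,\gamma\in[0,2\pi),\ p,q\in[0,1],\ p^2+q^2=1.$$ $\|A\|_\infty=\max_{j,k}|a_{jk}|$ for a $2\times2$ matrix $A=[a_{jk}]$, and $\langle x\rangle=\sqrt{1+x^2}$. The essential spectrum is $\sigma_{ess}(U)=\sigma(U)\setminus\sigma_d(U)$, where $\sigma_d(U)$ is the set of isolated points of $\sigma(U)$ that are eigenvalues of finite multiplicity. An eigenvalue of $U$ is a number $e^{i\theta}$ such that $U\psi=e^{i\theta}\psi$ has a nonzero solution $\psi\in\mathcal{H}$. *)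

(* Defs.v *)
From HB Require Import structures.
From mathcomp Require Import all_boot all_order all_algebra.
From mathcomp Require Import spectral.
From mathcomp Require Import complex.
From mathcomp Require Import all_classical all_reals all_analysis.
From mathcomp Require Import ring.

Set Implicit Arguments.
Unset Strict Implicit.
Unset Printing Implicit Defensive.

Import Order.TTheory GRing.Theory Num.Theory.
Import numFieldNormedType.Exports.
Import Normc.

Local Open Scope classical_set_scope.
Local Open Scope ring_scope.
Local Open Scope complex_scope.
Local Open Scope sesquilinear_scope.

(* Subsets of the scalars are typed as sets of K^o, which carries the norm
   topology used by `isolated`. *)
Section spectral_theory.
Context {K : numFieldType} {V : normedModType K}.
Implicit Types (T : {linear V -> V}) (z : K^o).

Definition resolvent_set T : set K^o :=
  [set z | exists S : {linear V -> V}, [/\ continuous S,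
     cancel (fun v => T v - z *: v) S & cancel S (fun v => T v - z *: v)]].

Definition spectrum T : set K^o := ~` resolvent_set T.

Definition is_eigenvalue T z : Prop := exists2 v : V, v != 0 & T v = z *: v.

(* Geometric multiplicity: for a normal operator it is the algebraic one. *)
Definition finite_multiplicity T z : Prop :=
  exists (n : nat) (e : 'I_n -> V), forall v, T v = z *: v ->
    exists c : 'I_n -> K, v = \sum_i c i *: e i.

Definition discrete_spectrum T : set K^o :=
  [set z | [/\ isolated (spectrum T) z, is_eigenvalue T z
             & finite_multiplicity T z]].

Definition ess_spectrum T : set K^o := spectrum T `\` discrete_spectrum T.

End spectral_theory.

Section l2_space.
Context {R : realType}.
Local Notation C2field := (int -> 'cV[R[i]]_2).
Implicit Types (psi phi : C2field).

Definition sqn (v : 'cV[R[i]]_2) : R := \sum_j normc (v j 0) ^+ 2.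

Definition l2mass psi : \bar R := \esum_(x in [set: int]) (sqn (psi x))%:E.

Definition square_summable : {pred C2field} := [pred psi | `[< (l2mass psi < +oo)%E >]].

Lemma sqn_ge0 v : 0 <= sqn v.
Proof. by apply: sumr_ge0 => j _; rewrite sqr_ge0. Qed.

Lemma sqn_eq0 v : sqn v = 0 -> v = 0.
Proof.
move=> /eqP; rewrite psumr_eq0 => [/allP v0|j _]; last by rewrite sqr_ge0.
apply/colP => j; rewrite mxE; apply: eq0_normc; apply/eqP.
by have := v0 j (mem_index_enum j); rewrite /= sqrf_eq0.
Qed.

Lemma sqnZ a v : sqn (a *: v) = normc a ^+ 2 * sqn v.
Proof. by rewrite mulr_sumr; apply: eq_bigr => j _; rewrite mxE normcM exprMn. Qed.

Lemma sqnD t v w : 0 < t ->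
  sqn (v + w) <= (1 + t) * sqn v + (1 + t^-1) * sqn w.
Proof.
move=> t0; rewrite !mulr_sumr -big_split/=; apply: ler_sum => j _; rewrite mxE.
set a := v j 0; set b := w j 0.
have a0 : 0 <= normc a by case: (a) => ? ?; rewrite sqrtr_ge0.
have b0 : 0 <= normc b by case: (b) => ? ?; rewrite sqrtr_ge0.
have ab0 : 0 <= normc (a + b) by case: (a + b) => ? ?; rewrite sqrtr_ge0.
apply: (@le_trans _ _ ((normc a + normc b) ^+ 2)).
  by rewrite ler_pXn2r ?nnegrE ?addr_ge0// le_normcD.
rewrite -subr_ge0.
suff -> : (1 + t) * normc a ^+ 2 + (1 + t^-1) * normc b ^+ 2
  - (normc a + normc b) ^+ 2 = t^-1 * (t * normc a - normc b) ^+ 2.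
  by rewrite mulr_ge0 ?sqr_ge0 ?invr_ge0 ?ltW.
by field; rewrite gt_eqF.
Qed.

Lemma esumZ (k : R) (f : int -> R) : 0 <= k ->
  (\esum_(x in [set: int]) (k * f x)%:E =
   k%:E * \esum_(x in [set: int]) (f x)%:E)%E.
Proof.
move=> k0; rewrite /esum -ereal_supZl//; last first.
  by apply/set0P; exists 0%E; exists set0; [exact: fsets_set0|rewrite fsbig_set0].
congr ereal_sup; apply/seteqP; split => [_ [A [finA AT]] <-|_ [_ [A [finA AT] <-]] <-].
- exists (\sum_(x \in A) (f x)%:E)%E; first by exists A.
  by rewrite !fsumEFin// -EFinM mulr_fsumr.
- by exists A => //; rewrite !fsumEFin// -EFinM mulr_fsumr.
Qed.

Lemma l2mass_ge0 psi : (0 <= l2mass psi)%E.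
Proof. by apply: esum_ge0 => x _; rewrite lee_fin sqn_ge0. Qed.

Lemma square_summableE psi :
  (psi \in square_summable) = (l2mass psi \is a fin_num).
Proof. by rewrite inE ge0_fin_numE ?l2mass_ge0// asboolb. Qed.

Lemma l2massZ a psi : l2mass (a *: psi) = ((normc a ^+ 2)%:E * l2mass psi)%E.
Proof.
rewrite /l2mass -esumZ ?sqr_ge0//; apply: eq_esum => x _.
by rewrite -sqnZ.
Qed.

Lemma l2massD t psi phi : 0 < t ->
  (l2mass (psi + phi)%R <=
   (1 + t)%R%:E * l2mass psi + (1 + t^-1)%R%:E * l2mass phi)%E.
Proof.
move=> t0; have ti0 : 0 < t^-1 by rewrite invr_gt0.
have t1 : 0 <= 1 + t by rewrite addr_ge0// ltW.
have ti1 : 0 <= 1 + t^-1 by rewrite addr_ge0// ltW.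
rewrite /l2mass -!esumZ// -esumD; [|by move=> x _; rewrite lee_fin mulr_ge0 ?sqn_ge0..].
by apply: le_esum => x _; rewrite -EFinD lee_fin sqnD.
Qed.

Lemma l2mass0 : l2mass 0 = 0%E.
Proof.
rewrite /l2mass esum1// => x _.
by rewrite /sqn big1// => j _; rewrite mxE normc0 expr0n.
Qed.

Fact square_summable_submod_closed : submod_closed square_summable.
Proof.
split=> [|a psi phi]; rewrite !square_summableE ?l2mass0// => fpsi fphi.
rewrite ge0_fin_numE ?l2mass_ge0//.
apply: le_lt_trans (l2massD _ _ (@ltr01 R)) _.
by rewrite ltey_eq l2massZ fin_numD !fin_numM.
Qed.

HB.instance Definition _ :=
  GRing.isSubmodClosed.Build R[i] C2field square_summable
    square_summable_submod_closed.

End l2_space.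

(* The Hilbert space l^2(Z; C^2): component j of psi at the site x is
   psi x j 0, with j : 'I_2. *)
Record l2 (R : realType) := L2 {
  l2_fun :> int -> 'cV[R[i]]_2;
  l2_funP : l2_fun \in square_summable }.

HB.instance Definition _ (R : realType) := [isSub for @l2_fun R].
HB.instance Definition _ (R : realType) := [Choice of l2 R by <:].
HB.instance Definition _ (R : realType) :=
  [SubChoice_isSubLmodule of l2 R by <:].

Section l2_norm.
Context {R : realType}.
Implicit Types psi phi : l2 R.

Definition l2norm psi : R := Num.sqrt (fine (l2mass psi)).

Lemma l2norm_ge0 psi : 0 <= l2norm psi. Proof. exact: sqrtr_ge0. Qed.

Lemma l2mass_fin psi : l2mass psi \is a fin_num.
Proof. by rewrite -square_summableE l2_funP. Qed.

Lemma l2massE psi : l2mass psi = (l2norm psi ^+ 2)%:E.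
Proof. by rewrite sqr_sqrtr ?fine_ge0 ?l2mass_ge0// fineK// l2mass_fin. Qed.

Lemma l2norm0_eq0 psi : l2norm psi = 0 -> psi = 0.
Proof.
move=> psi0; apply/val_inj/funext => x /=; apply: sqn_eq0.
apply/eqP; rewrite eq_le sqn_ge0 andbT -lee_fin.
apply: (@le_trans _ _ (l2mass psi)); last by rewrite l2massE psi0 expr0n.
rewrite -[leLHS](@esum_set1 _ _ x (fun y => (sqn (psi y))%:E)) ?lee_fin ?sqn_ge0//.
apply: le_ereal_sup => _ [A [finA AT] <-].
by exists A.
Qed.

Lemma l2normZ (a : R[i]) psi : l2norm (a *: psi) = normc a * l2norm psi.
Proof.
rewrite /l2norm l2massZ fineM ?l2mass_fin//= sqrtrM ?sqr_ge0// sqrtr_sqr ger0_norm//.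
by case: a => ? ?; rewrite sqrtr_ge0.
Qed.

Lemma ler_l2normD psi phi : l2norm (psi + phi) <= l2norm psi + l2norm phi.
Proof.
have [/l2norm0_eq0 ->|s0] := eqVneq (l2norm psi) 0.
  by rewrite add0r lerDr l2norm_ge0.
have [/l2norm0_eq0 ->|r0] := eqVneq (l2norm phi) 0.
  by rewrite addr0 lerDl l2norm_ge0.
have {}s0 : 0 < l2norm psi by rewrite lt_def s0 l2norm_ge0.
have {}r0 : 0 < l2norm phi by rewrite lt_def r0 l2norm_ge0.
rewrite -(@ler_pXn2r _ 2)// ?nnegrE ?addr_ge0 ?l2norm_ge0//.
have : (l2mass (psi + phi : l2 R)%R <= _)%E :=
  l2massD psi phi (divr_gt0 r0 s0).
rewrite !l2massE -!EFinM -EFinD lee_fin.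
move=> /le_trans; apply; rewrite le_eqVlt; apply/orP; left; apply/eqP.
by field; rewrite !gt_eqF.
Qed.

Fact ler_normD_l2 psi phi :
  (l2norm (psi + phi))%:C <= (l2norm psi)%:C + (l2norm phi)%:C.
Proof. by rewrite -rmorphD/= lecR ler_l2normD. Qed.

Fact normrZ_l2 (a : R[i]) psi : (l2norm (a *: psi))%:C = `|a| * (l2norm psi)%:C.
Proof. by rewrite l2normZ rmorphM. Qed.

Fact normr0_eq0_l2 psi : (l2norm psi)%:C = 0 -> psi = 0.
Proof. by case=> /l2norm0_eq0. Qed.

HB.instance Definition _ := @Lmodule_isNormed.Build R[i] (l2 R)
  (fun psi => (l2norm psi)%:C) ler_normD_l2 normrZ_l2 normr0_eq0_l2.

End l2_norm.

Section quantum_walk.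
Context {R : realType}.
Local Notation C2field := (int -> 'cV[R[i]]_2).

Definition shift_fun (psi : C2field) : C2field :=
  fun x => \col_j (if j == 0 then psi (x + 1) 0 0 else psi (x - 1) 1 0).

Definition coin_fun (C : int -> 'M[R[i]]_2) (psi : C2field) : C2field :=
  fun x => C x *m psi x.

Lemma sqn_unitary (A : 'M[R[i]]_2) v : A \is unitarymx -> sqn (A *m v) = sqn v.
Proof.
have sqnE w : (sqn w)%:C = (w^t* *m w) 0 0.
  rewrite rmorph_sum mxE; apply: eq_bigr => j _ /=.
  by rewrite !mxE mulrC -normCK rmorphXn.
move=> /unitarymxP/mulmx1C AA; apply: (@complexI R); rewrite !sqnE.
by rewrite trmx_mul map_mxM /= mulmxA -(mulmxA (v^t*)) AA mulmx1.
Qed.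

Lemma l2mass_coin C psi : (forall x, C x \is unitarymx) ->
  l2mass (coin_fun C psi) = l2mass psi.
Proof. by move=> uC; apply: eq_esum => x _; rewrite sqn_unitary. Qed.

Lemma l2mass_shift psi : l2mass (shift_fun psi) = l2mass psi.
Proof.
have split2 phi : l2mass phi =
    (\esum_(x in [set: int]) (normc (phi x 0%R 0%R) ^+ 2)%:E +
     \esum_(x in [set: int]) (normc (phi x 1%R 0%R) ^+ 2)%:E)%E.
  rewrite -esumD; [|by move=> x _; rewrite lee_fin sqr_ge0..].
  apply: eq_esum => x _; rewrite /sqn !big_ord_recl big_ord0 addr0 -EFinD.
  by congr (_ + normc (phi x _ _) ^+ 2)%:E; apply: val_inj.
have shiftE (k : int) (f : int -> \bar R) :
    (\esum_(x in [set: int]) f x = \esum_(x in [set: int]) f (x + k)%R)%E.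
  apply: reindex_esum; split => // [x y _ _ /addIr //|y _].
  by exists (y - k) => //; rewrite subrK.
rewrite !split2; congr (_ + _)%E.
- rewrite [RHS](shiftE 1); apply: eq_esum => x _.
  by rewrite /shift_fun mxE.
- rewrite [RHS](shiftE (- 1)); apply: eq_esum => x _.
  by rewrite /shift_fun mxE.
Qed.

Fact shiftP (psi : l2 R) : shift_fun psi \in square_summable.
Proof. by rewrite square_summableE l2mass_shift l2mass_fin. Qed.

Definition walk_shift (psi : l2 R) : l2 R := L2 (shiftP psi).

Fact shift_linear : linear walk_shift.
Proof.
move=> a psi phi; apply/val_inj/funext => x; apply/colP => j /=.
by rewrite /shift_fun /= !mxE; case: ifP.
Qed.

HB.instance Definition _ :=
  GRing.isLinear.Build R[i] (l2 R) (l2 R) _ walk_shift shift_linear.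

Section coin_operator.
Context (C : int -> 'M[R[i]]_2) (unitC : forall x, C x \is unitarymx).

Fact coinP (psi : l2 R) : coin_fun C psi \in square_summable.
Proof. by rewrite square_summableE l2mass_coin// l2mass_fin. Qed.

Definition walk_coin (psi : l2 R) : l2 R := L2 (coinP psi).

Fact coin_linear : linear walk_coin.
Proof.
move=> a psi phi; apply/val_inj/funext => x /=.
by rewrite /coin_fun /= mulmxDr -scalemxAr.
Qed.

HB.instance Definition _ :=
  GRing.isLinear.Build R[i] (l2 R) (l2 R) _ walk_coin coin_linear.

Definition walk : {linear l2 R -> l2 R} := walk_shift \o walk_coin.

End coin_operator.

End quantum_walk.

Section model.
Context {R : realType}.

Definition expi (theta : R) : R[i] := cos theta +i* sin theta.

Definition C0 (p q alpha beta gamma : R) : 'M[R[i]]_2 :=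
  \matrix_(j, k)
    if j == 0
    then (if k == 0 then p%:C * expi alpha else q%:C * expi beta)
    else (if k == 0 then - q%:C * expi (- (beta - gamma))
          else p%:C * expi (- (alpha - gamma))).

Definition japanese (x : int) : R := Num.sqrt (1 + x%:~R ^+ 2).

Definition J1 (p gamma : R) : set R :=
  `[acos p + gamma / 2, pi - acos p + gamma / 2]%classic.

Definition J2 (p gamma : R) : set R :=
  `[pi + acos p + gamma / 2, 2 * pi - acos p + gamma / 2]%classic.

Definition J (p gamma : R) : set R := J1 p gamma `|` J2 p gamma.

Definition JT (p gamma : R) : set R :=
  [set acos p + gamma / 2; pi - acos p + gamma / 2;
       pi + acos p + gamma / 2; 2 * pi - acos p + gamma / 2].

Definition thresholds (U : {linear l2 R -> l2 R}) (p gamma : R) : set R[i]^o :=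
  [set z | ess_spectrum U z /\ exists2 theta, JT p gamma theta & z = expi theta].

End model.

(* Main.v *)
Require Import Defs.
From HB Require Import structures.
From mathcomp Require Import all_boot all_order all_algebra.
From mathcomp Require Import spectral complex.
From mathcomp Require Import all_classical all_reals all_analysis.
From mathcomp Require Import ring lra zify.

(* On |z| = 1 write zeta = z e^{-i gamma/2}; the arcs are {|Re zeta| <= p}.

   Outside the arcs: the constant walk W satisfies the Cayley-Hamilton identity
   W^2 + e^{i gamma} = (a L + d L^-1) W, with L a translation and |a| = |d| = p,
   so W - z is bounded below by |Re zeta| - p.  Since C(x) -> C0, the operator
   U - z is then bounded below up to finitely many sites.  By weak compactness
   a spectral point is an eigenvalue, and it is isolated because eigenvectors
   for distinct eigenvalues of an isometry are orthogonal.

   Inside the arcs (|Re zeta| < p): the transfer matrix of the constant walk is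
   an elliptic element of SU(1,1), up to a phase, so it preserves a definite
   Hermitian form.  Exponential decay of the perturbation keeps this form of any
   solution of U psi = z psi between two positive constants at +oo.  Hence no
   solution is square summable, and truncated solutions form Weyl sequences. *)

Set Implicit Arguments.
Unset Strict Implicit.
Unset Printing Implicit Defensive.

Import Order.TTheory GRing.Theory Num.Theory.
Import numFieldNormedType.Exports.
Import Normc.

Local Open Scope classical_set_scope.
Local Open Scope ring_scope.
Local Open Scope sesquilinear_scope.
Local Open Scope complex_scope.

Local Notation Re := complex.Re.
Local Notation Im := complex.Im.
Local Notation "x ^*" := (conjc x) : ring_scope.

(** * Finite sums and norms in l2 *)

(** The argument runs on norms alone. Orthogonality comes from a norm identity in place of an inner
    product, and surjectivity of [U - z] is extracted from a lower bound by Neumann series whose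
    sums are weak limits. [ess_spectrum] removes the isolated eigenvalues of finite multiplicity, so
    an arc point belongs to it as soon as it is spectral and a limit of other spectral points; since
    [p > 0] the arcs have no isolated point. The points with [|Re zeta| = p] are reached from the
    interior, because a lower bound for [U - z] survives a small change of [z]. At these points the
    invariant form degenerates, so nothing is claimed there about eigenvalues. One half-line decides
    the interior: the bound [|a(x)| >= delta] makes the recurrence reversible, hence a solution is
    determined by its state at one site and estimates near +oo control it entirely. Outside the arcs
    the same fact bounds the dimension of every eigenspace by 2. *)

Section square_norm.
Context {R : realType}.
Implicit Types (a b : R[i]) (u v w : 'cV[R[i]]_2).

Lemma normc_ge0 a : 0 <= normc a.
Proof. by case: a => x y; exact: sqrtr_ge0. Qed.

Lemma sqr_normcE a : normc a ^+ 2 = Re a ^+ 2 + Im a ^+ 2.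
Proof. by case: a => x y; rewrite sqr_sqrtr// addr_ge0 ?sqr_ge0. Qed.

Lemma normc_eq1 a : normc a = 1 -> a^-1 = a^*.
Proof.
move=> a1; rewrite invc_norm -[`|a|]/(normc a)%:C a1.
by rewrite expr1n invr1 mul1r.
Qed.

Lemma normc_real (x : R) : normc x%:C = `|x|.
Proof. by rewrite /= expr0n addr0 sqrtr_sqr. Qed.

Lemma normc_conj a : normc a^* = normc a.
Proof. by case: a => x y /=; rewrite sqrrN. Qed.

Lemma conjcM a b : (a * b)^* = a^* * b^*.
Proof. by case: a b => ? ? [? ?]; rewrite /GRing.mul/=; congr Complex; ring. Qed.

Lemma conjcN a : (- a)^* = - a^*.
Proof. by case: a. Qed.

Lemma mulc_conj a : a * a^* = (normc a ^+ 2)%:C.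
Proof. by rewrite rmorphXn /= -[(normc a)%:C]/(`|a|) sqr_normc. Qed.

Lemma normc_distC a b : normc (a - b) = normc (b - a).
Proof. by rewrite -(normcN (a - b)) opprB. Qed.

Lemma normc_sub_ge a b : normc a - normc b <= normc (a - b).
Proof. by rewrite lerBlDr; apply: le_trans (le_normcD _ _); rewrite subrK. Qed.

Lemma normc_Re a : `|Re a| <= normc a.
Proof.
by case: a => x y /=; rewrite -sqrtr_sqr ler_wsqrtr// lerDl sqr_ge0.
Qed.

Lemma sqnE v : sqn v = normc (v 0 0) ^+ 2 + normc (v 1 0) ^+ 2.
Proof.
rewrite /sqn !big_ord_recl big_ord0 addr0; congr (_ + normc (v _ _) ^+ 2).
exact: val_inj.
Qed.

Lemma sqnN v : sqn (- v) = sqn v.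
Proof. by rewrite !sqnE !mxE !normcN. Qed.

Lemma sqn_add2 u v : sqn (u + v) <= 2 * sqn u + 2 * sqn v.
Proof. by have := sqnD u v (@ltr01 R); rewrite invr1. Qed.

(** Fréchet's identity, which singles out norms that come from an inner product. It makes the
    polarization of the squared norm additive. *)
Lemma sqn_triple u v w :
  sqn (u + v + w) + (sqn u + (sqn v + sqn w)) =
  sqn (u + v) + (sqn (v + w) + sqn (u + w)).
Proof.
rewrite !sqnE !sqr_normcE !mxE.
case: (u 0 0) (u 1 0) (v 0 0) (v 1 0) (w 0 0) (w 1 0) =>
  ? ? [? ?] [? ?] [? ?] [? ?] [? ?] /=.
ring.
Qed.

End square_norm.

Section l2_finite_sums.
Context {R : realType}.
Implicit Types (psi phi : l2 R) (s : seq int).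

Lemma sum_sub_le (T : eqType) (s s' : seq T) (F : T -> R) :
  uniq s -> uniq s' -> {subset s <= s'} -> (forall x, 0 <= F x) ->
  \sum_(x <- s) F x <= \sum_(x <- s') F x.
Proof.
move=> us us' ss' F0; rewrite [leRHS](bigID (mem s))/=.
rewrite -[X in _ <= X + _]big_filter.
rewrite (perm_big s (r1 := [seq x <- s' | x \in s]))/=; last first.
  apply: uniq_perm; [exact: filter_uniq|exact: us|].
  by move=> x; rewrite mem_filter andb_idr//; exact: ss'.
by rewrite lerDl sumr_ge0.
Qed.

Lemma sum_sqn_le psi s : uniq s ->
  \sum_(x <- s) sqn (psi x) <= l2norm psi ^+ 2.
Proof.
move=> us; rewrite -lee_fin -l2massE; apply: esum_ge.
exists [set` s]; first by split => //; exact: finite_seq.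
by rewrite -fsbig_seq// sumEFin.
Qed.

Lemma sqn_le_l2norm psi x : sqn (psi x) <= l2norm psi ^+ 2.
Proof. by have := @sum_sqn_le psi [:: x] erefl; rewrite big_seq1. Qed.

Lemma l2mass_le (psi : int -> 'cV[R[i]]_2) (B : R) :
  (forall s, uniq s -> \sum_(x <- s) sqn (psi x) <= B) -> (l2mass psi <= B%:E)%E.
Proof.
move=> sB; rewrite /l2mass; apply: ge_ereal_sup => _ [A [finA _] <-].
by rewrite fsbig_finite// sumEFin lee_fin sB//; exact: finmap.fset_uniq.
Qed.

Lemma square_summable_bounded (psi : int -> 'cV[R[i]]_2) (B : R) :
  (forall s, uniq s -> \sum_(x <- s) sqn (psi x) <= B) ->
  psi \in square_summable.
Proof.
move=> /l2mass_le sB; rewrite square_summableE ge0_fin_numE ?l2mass_ge0//.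
exact: le_lt_trans sB (ltry _).
Qed.

Lemma l2norm_sqr_le psi (B : R) :
  (forall s, uniq s -> \sum_(x <- s) sqn (psi x) <= B) -> l2norm psi ^+ 2 <= B.
Proof. by move=> /l2mass_le; rewrite l2massE lee_fin. Qed.

Lemma sum_sqn_le_supp (psi : int -> 'cV[R[i]]_2) s t : uniq s -> uniq t ->
  (forall x, x \notin s -> psi x = 0) ->
  \sum_(x <- t) sqn (psi x) <= \sum_(x <- s) sqn (psi x).
Proof.
move=> us ut psi0.
rewrite (bigID (mem s))/= [X in _ + X]big1 => [|x /psi0 ->]; last first.
  by rewrite sqnE !mxE normc0 expr0n addr0.
rewrite addr0 -big_filter; apply: sum_sub_le => //; first exact: filter_uniq.
  by move=> x; rewrite mem_filter => /andP[].
by move=> x; exact: sqn_ge0.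
Qed.

Lemma l2norm_sqr_le_supp psi s : uniq s -> (forall x, x \notin s -> psi x = 0) ->
  l2norm psi ^+ 2 <= \sum_(x <- s) sqn (psi x).
Proof. by move=> us psi0; apply: l2norm_sqr_le => t ut; exact: sum_sqn_le_supp. Qed.

Lemma l2norm0 : l2norm (0 : l2 R) = 0.
Proof. by have := l2normZ 0 (0 : l2 R); rewrite scale0r normc0 mul0r. Qed.

Lemma l2norm_eq0 psi : (l2norm psi == 0) = (psi == 0).
Proof. by apply/eqP/eqP => [/l2norm0_eq0 //|->]; exact: l2norm0. Qed.

Lemma l2norm_gt0 psi : (0 < l2norm psi) = (psi != 0).
Proof. by rewrite lt_def l2norm_ge0 andbT l2norm_eq0. Qed.

Lemma l2normN psi : l2norm (- psi) = l2norm psi.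
Proof. by rewrite -scaleN1r l2normZ normcN normc1 mul1r. Qed.

Lemma l2norm_distC psi phi : l2norm (psi - phi) = l2norm (phi - psi).
Proof. by rewrite -l2normN opprB. Qed.

Lemma l2norm_sub_ge psi phi : l2norm psi - l2norm phi <= l2norm (psi - phi).
Proof. by rewrite lerBlDr; apply: le_trans (ler_l2normD _ _); rewrite subrK. Qed.

(** The four-against-three shape is that of [sqn_triple]. It is free of subtraction because masses
    are sums in the extended reals, which add termwise when the terms are nonnegative. *)
Lemma sum_l2norm_eq (a b c d a' b' c' : l2 R) :
  (forall x, sqn (a x) + (sqn (b x) + (sqn (c x) + sqn (d x))) =
             sqn (a' x) + (sqn (b' x) + sqn (c' x))) ->
  l2norm a ^+ 2 + (l2norm b ^+ 2 + (l2norm c ^+ 2 + l2norm d ^+ 2)) =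
  l2norm a' ^+ 2 + (l2norm b' ^+ 2 + l2norm c' ^+ 2).
Proof.
move=> abcd.
have D (F G : int -> R) : (forall x, 0 <= F x) -> (forall x, 0 <= G x) ->
    (\esum_(x in [set: int]) (F x)%:E + \esum_(x in [set: int]) (G x)%:E =
     \esum_(x in [set: int]) (F x + G x)%:E)%E.
  move=> F0 G0; rewrite -esumD; first by apply: eq_esum => x _; rewrite EFinD.
  - by move=> x _; rewrite lee_fin.
  - by move=> x _; rewrite lee_fin.
have q0 (k : l2 R) x : 0 <= sqn (k x) by exact: sqn_ge0.
have q1 (k l : l2 R) x : 0 <= sqn (k x) + sqn (l x) by exact: addr_ge0.
have q2 (k l m : l2 R) x : 0 <= sqn (k x) + (sqn (l x) + sqn (m x)).
  exact: addr_ge0.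
suff: (l2mass a + (l2mass b + (l2mass c + l2mass d)) =
       l2mass a' + (l2mass b' + l2mass c'))%E.
  by rewrite !l2massE => -[].
rewrite /l2mass (D (fun x => sqn (c x)))// (D (fun x => sqn (b x)))//.
rewrite (D (fun x => sqn (a x)))// (D (fun x => sqn (b' x)))//.
rewrite (D (fun x => sqn (a' x)))//.
by apply: eq_esum => x _; rewrite abcd.
Qed.

Lemma l2norm_triple (f g h : l2 R) :
  l2norm (f + g + h) ^+ 2 + (l2norm f ^+ 2 + (l2norm g ^+ 2 + l2norm h ^+ 2)) =
  l2norm (f + g) ^+ 2 + (l2norm (g + h) ^+ 2 + l2norm (f + h) ^+ 2).
Proof. by apply: sum_l2norm_eq => x; exact: sqn_triple. Qed.

Lemma l2norm_parallelogram psi phi :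
  l2norm (psi + phi) ^+ 2 + l2norm (psi - phi) ^+ 2 =
  2 * l2norm psi ^+ 2 + 2 * l2norm phi ^+ 2.
Proof.
have := l2norm_triple psi phi (- phi); rewrite addrK subrr l2norm0 l2normN; lra.
Qed.

End l2_finite_sums.

(** * Weak compactness and Neumann series *)

Section weak_compactness.
Context {R : realType}.

(** Compactness of [[-B, B]] gives a cluster point, and a cluster point along an ultrafilter is a
    limit: of a neighbourhood and its complement, one belongs to [F]. Squares match the use of
    [sqn]. *)
Lemma ultra_bounded_cvg (F : set_system nat) (f : nat -> R) (B : R) :
  UltraFilter F -> (forall n, `|f n| <= B) ->
  exists l : R, forall e, 0 < e -> F [set n | (f n - l) ^+ 2 < e].
Proof.
move=> UF fB.
have [l [_ clf]] : `[- B, B]%classic `&` cluster (f @ F) !=set0.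
  apply: (@segment_compact _ (- B) B).
  rewrite nbhs_simpl; apply: (@filterS _ F _ setT); last exact: filterT.
  by move=> n _ /=; rewrite in_itv/= -ler_norml.
exists l => e e0; have [//|FnA] := in_ultra_setVsetC [set n | (f n - l) ^+ 2 < e] UF.
have [] := clf (~` [set x | (x - l) ^+ 2 < e]) (ball l (Num.sqrt e)) FnA.
  by apply: nbhsx_ballx; rewrite sqrtr_gt0.
move=> y [/= nye]; rewrite /ball/= => lye; exfalso; apply: nye.
rewrite -real_normK ?num_real// distrC -[ltRHS]sqr_sqrtr ?(ltW e0)//.
by rewrite ltr_pXn2r// nnegrE ?sqrtr_ge0.
Qed.

(* The limit is taken along an ultrafilter, which gives pointwise convergence
   at all sites without extracting subsequences. *)
Lemma weak_compact (u : nat -> l2 R) (B : R) : (forall n, l2norm (u n) <= B) ->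
  exists psi : l2 R, forall (s : seq int) (e : R) (N : nat), 0 < e ->
    exists2 n, (N <= n)%N & forall x, x \in s -> sqn (u n x - psi x) < e.
Proof.
move=> uB.
have [F [UF sF]] := @ultraFilterLemma nat \oo _.
have PF : ProperFilter F := @ultra_proper _ F UF.
have FF : Filter F := @filter_filter _ F PF.
have B0 : 0 <= B by exact: le_trans (l2norm_ge0 (u 0%N)) (uB 0%N).
have coordB n x j : normc (u n x j 0) <= B.
  rewrite -(@ler_pXn2r _ 2)// ?nnegrE ?normc_ge0//.
  apply: (@le_trans _ _ (sqn (u n x))).
    by rewrite /sqn (bigD1 j)//= lerDl sumr_ge0// => k _; rewrite sqr_ge0.
  by apply: le_trans (sqn_le_l2norm _ _) _; rewrite ler_pXn2r ?nnegrE ?l2norm_ge0.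
have limP (f : R[i] -> R) : (forall a, `|f a| <= normc a) ->
    {l : int -> 'I_2 -> R | forall x j e, 0 < e ->
       F [set n | (f (u n x j 0) - l x j) ^+ 2 < e]}.
  move=> fle; suff /choice[l lP] : forall p : int * 'I_2, exists l, forall e, 0 < e ->
      F [set n | (f (u n p.1 p.2 0) - l) ^+ 2 < e].
    by exists (fun x j => l (x, j)) => x j e e0; exact: lP (x, j) e e0.
  move=> [x j]; apply: (ultra_bounded_cvg (B := B)) => n /=.
  exact: le_trans (fle _) (coordB _ _ _).
have [lr lrP] := limP (@complex.Re R) normc_Re.
have [li liP] : {l : int -> 'I_2 -> R | forall x j e, 0 < e ->
       F [set n | (Im (u n x j 0) - l x j) ^+ 2 < e]}.
  apply: (limP (@complex.Im R)) => -[a b] /=; rewrite -sqrtr_sqr ler_wsqrtr// lerDr sqr_ge0 //.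
pose psi0 x : 'cV[R[i]]_2 := \col_j (lr x j +i* li x j).
have psi1 x e : 0 < e -> F [set n | sqn (u n x - psi0 x) < e].
  move=> e0; have e4 : 0 < e / 4 by rewrite divr_gt0.
  have F0 := @filterI _ F FF _ _ (lrP x 0 _ e4) (liP x 0 _ e4).
  have F1 := @filterI _ F FF _ _ (lrP x 1 _ e4) (liP x 1 _ e4).
  apply: (@filterS _ F FF _ _ _ (@filterI _ F FF _ _ F0 F1)) => n /= [[]].
  rewrite sqnE !sqr_normcE !mxE.
  by case: (u n x 0 0) (u n x 1 0) => ? ? [? ?] /= ? ? [? ?]; lra.
have psis (s : seq int) e : 0 < e -> F [set n | forall x, x \in s -> sqn (u n x - psi0 x) < e].
  move=> e0; elim: s => [|x s IHs]; first by apply: (@filterS _ F FF setT) => //; exact: filterT.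
  apply: (@filterS _ F FF _ _ _ (@filterI _ F FF _ _ (psi1 x e e0) IHs)) => n /= [xe se] y.
  by rewrite inE => /predU1P[->|/se].
have psi_l2 : psi0 \in square_summable.
  apply: (@square_summable_bounded _ _ (2 * B ^+ 2 + 2)) => s us.
  (* Fatou's argument: with this error at each site of [s], the total error over [s] stays below 1,
     whatever [s] is. *)
  pose e : R := ((size s).+1%:R)^-1.
  have e0 : 0 < e by rewrite invr_gt0.
  have [n /= nse] := @filter_ex _ F PF _ (psis s e e0).
  have le1 : \sum_(x <- s) sqn (psi0 x) <=
      \sum_(x <- s) (2 * sqn (u n x) + 2 * e).
    rewrite big_seq [leRHS]big_seq; apply: ler_sum => x xs.
    rewrite -[psi0 x](subrK (u n x)) addrC.
    apply: le_trans (sqn_add2 _ _) _; rewrite lerD2l ler_pM2l//.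
    by rewrite -sqnN opprB ltW// nse.
  apply: le_trans le1 _; rewrite big_split/= -mulr_sumr lerD//.
    rewrite ler_pM2l//; apply: le_trans (sum_sqn_le _ us) _.
    by rewrite ler_pXn2r ?nnegrE ?l2norm_ge0.
  rewrite big_const_seq count_predT iter_addr_0 -[leLHS]mulr_natr -mulrA ler_piMr//.
  by rewrite mulrC ler_pdivrMr ?mul1r ?ler_nat ?ltr0Sn.
exists (L2 psi_l2) => s e N e0.
have FN : F [set n | (N <= n)%N] by apply: sF; exists N.
by have [n [Nn ns]] := @filter_ex _ F PF _ (@filterI _ F FF _ _ FN (psis s e e0)); exists n.
Qed.

End weak_compactness.

Section neumann.
Context {R : realType}.
Implicit Types (T : {linear l2 R -> l2 R}) (psi phi : l2 R).

(** For linear maps this gives continuity for sitewise convergence, which is what lets an equation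
    pass to a weak limit. *)
Definition finite_range (T : l2 R -> l2 R) := forall x, exists s K, 0 <= K /\
  forall psi, sqn (T psi x) <= K * \sum_(y <- s) sqn (psi y).

Lemma le0_small (a K : R) : (forall e, 0 < e -> a <= K * e) -> a <= 0.
Proof.
move=> aK; rewrite leNgt; apply/negP => a0.
have K0 : 0 < 1 + `|K| by rewrite ltr_pwDl.
pose e := a / (2 * (1 + `|K|)).
have e0 : 0 < e by rewrite divr_gt0 ?mulr_gt0.
have eE : (1 + `|K|) * e = a / 2 by rewrite /e; field; rewrite gt_eqF.
have := ler_wpM2r (ltW e0) (ler_norm K).
have := aK _ e0; lra.
Qed.

Lemma expr_small (z K e : R) : 0 <= z < 1 -> 0 < e ->
  exists N, forall n, (N <= n)%N -> z ^+ n * K < e.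
Proof.
move=> /andP[z0 z1] e0.
have /cvgr_lt/(_ e e0)[N _ NP] : (fun n => z ^+ n * K) @ \oo --> (0 : R).
  rewrite -(mul0r K); apply: cvgM; last exact: cvg_cst.
  by apply: cvg_expr; rewrite ger0_norm.
by exists N => n Nn; exact: NP.
Qed.

(** The iterates of [psi |-> phi + T psi] are bounded and their increments tend to 0. A weak limit
    therefore satisfies the fixed-point equation at each site, [T] being of finite range. *)
Lemma neumann T (r : R) phi : finite_range T -> 0 <= r < 1 ->
  (forall psi, l2norm (T psi) <= r * l2norm psi) ->
  exists psi, psi - T psi = phi.
Proof.
move=> Tloc /andP[r0 r1] Tr.
pose u n := iter n (fun psi => phi + T psi) 0.
have r1' : 0 < 1 - r by rewrite subr_gt0.
have uB n : l2norm (u n) <= l2norm phi / (1 - r).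
  elim: n => [|n IHn] /=.
    by rewrite l2norm0 divr_ge0 ?l2norm_ge0// ltW.
  apply: le_trans (ler_l2normD _ _) _.
  apply: (@le_trans _ _ (l2norm phi + r * (l2norm phi / (1 - r)))).
    by rewrite lerD2l; apply: le_trans (Tr _) _; rewrite ler_wpM2l.
  by rewrite le_eqVlt; apply/orP; left; apply/eqP; field; rewrite gt_eqF.
have dB n : l2norm (u n.+1 - u n) <= r ^+ n * l2norm phi.
  elim: n => [|n IHn] /=; first by rewrite linear0 addr0 subr0 expr0 mul1r.
  rewrite opprD addrACA subrr add0r -linearB.
  by apply: le_trans (Tr _) _; rewrite exprS -mulrA ler_wpM2l.
have [psi psiP] := weak_compact uB; exists psi.
apply/val_inj/funext => x /=; apply/eqP; rewrite -subr_eq0; apply/eqP/sqn_eq0/eqP.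
rewrite eq_le sqn_ge0 andbT; have [s [K [K0 TK]]] := Tloc x.
apply: (@le0_small _ (6 + 4 * K * (size s)%:R)) => e e0.
have r2 : 0 <= r ^+ 2 < 1 by rewrite sqr_ge0 expr_lt1.
have [N NP] := @expr_small (r ^+ 2) (l2norm phi ^+ 2) e r2 e0.
have [n Nn nP] := psiP (x :: s) e N e0.
pose d : l2 R := psi - u n.
have dx y : y \in x :: s -> sqn (d y) <= e.
  by move=> ys; rewrite -sqnN opprB; exact/ltW/nP.
(* The defect consists of the approximation error, its image under [T] and one increment; two uses
   of [sqn_add2] weight them by 4, 4 and 2, which explains [6 + 4 * K * (size s)%:R]. *)
have -> : psi x - T psi x - phi x = (d x - T d x) - (u n.+1 - u n : l2 R) x.
  rewrite /d linearB /=; set a := psi x; set b := T psi x.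
  by rewrite opprD opprB !opprD !addrA; apply/colP => j; rewrite !mxE; ring.
have un : sqn ((u n.+1 - u n : l2 R) x) <= e.
  apply: le_trans (sqn_le_l2norm _ _) _.
  apply: (@le_trans _ _ ((r ^+ n * l2norm phi) ^+ 2)).
    by rewrite ler_pXn2r ?nnegrE ?l2norm_ge0 ?mulr_ge0 ?l2norm_ge0 ?exprn_ge0.
  by rewrite exprMn -exprM mulnC exprM ltW// NP.
have Tdx : sqn (T d x) <= K * (size s)%:R * e.
  apply: le_trans (TK d) _; rewrite -mulrA ler_wpM2l// mulr_natl.
  rewrite -[leRHS]addr0 -iter_addr -count_predT -big_const_seq big_seq [leRHS]big_seq.
  by apply: ler_sum => y ys; apply: dx; rewrite inE ys orbT.
have := dx x (mem_head _ _).
have := sqn_add2 (d x - T d x) (- (u n.+1 - u n : l2 R) x).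
have := sqn_add2 (d x) (- T d x); rewrite !sqnN.
rewrite -(mulrA 4).
move: (K * (size s)%:R) (sqn (_ - _ - _)) un Tdx => K' A.
move: (sqn (_ - _)) (sqn (d x)) (sqn (T d x)) (sqn _) => a1 a2 a3 a4; lra.
Qed.

End neumann.

(** * Resolvent of a walk *)

Section finite_range_operators.
Context {R : realType}.
Implicit Types (S T : {linear l2 R -> l2 R}) (psi phi : l2 R).

Lemma finite_range_id : finite_range (@idfun (l2 R)).
Proof. by move=> x; exists [:: x], 1; split=> // psi; rewrite big_seq1 mul1r. Qed.

Lemma finite_rangeZ (a : R[i]) T : finite_range T -> finite_range (a \*: T).
Proof.
move=> Tf x; have [s [K [K0 TK]]] := Tf x; exists s, (normc a ^+ 2 * K).
split=> [|psi]; first by rewrite mulr_ge0 ?sqr_ge0.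
have -> : (a \*: T) psi x = a *: T psi x by [].
by rewrite sqnZ -(mulrA (_ ^+ 2)); apply: ler_wpM2l; rewrite ?sqr_ge0.
Qed.

Lemma finite_rangeD S T : finite_range S -> finite_range T ->
  finite_range (S \+ T).
Proof.
move=> Sf Tf x; have [s [K [K0 SK]]] := Sf x; have [t [L [L0 TL]]] := Tf x.
exists (s ++ t), (2 * K + 2 * L); split=> [|psi].
  by rewrite addr_ge0 ?mulr_ge0.
rewrite big_cat/=; apply: le_trans (sqn_add2 _ _) _.
have A0 : 0 <= \sum_(y <- s) sqn (psi y) by apply: sumr_ge0 => *; exact: sqn_ge0.
have B0 : 0 <= \sum_(y <- t) sqn (psi y) by apply: sumr_ge0 => *; exact: sqn_ge0.
have := SK psi; have := TL psi.
have := mulr_ge0 K0 B0; have := mulr_ge0 L0 A0.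
move: (sqn _) (sqn _) (\sum_(_ <- s) _) (\sum_(_ <- t) _) => a b A B; lra.
Qed.

End finite_range_operators.

Section resolvent_bounds.
Context {R : realType}.
Implicit Types (T : {linear l2 R -> l2 R}) (psi phi : l2 R) (z : R[i]).

Lemma resolvent_bounded_below T z : resolvent_set T z ->
  exists2 c : R, 0 < c & forall psi, c * l2norm psi <= l2norm (T psi - z *: psi).
Proof.
move=> [S [Sc TK _]].
have /pinfty_ex_gt0[[r ri] r0 rP] := (linear_boundedP S).1
  ((linear_bounded_continuous S).2 Sc).
move: r0; rewrite ltcE/= => /andP[/eqP ri0 r0]; rewrite ri0 in rP.
exists r^-1 => [|psi]; first by rewrite invr_gt0.
have := rP (T psi - z *: psi); rewrite (TK psi) -[`|psi|]/(l2norm psi)%:C.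
set phi := T psi - z *: psi; rewrite -[`|phi|]/(l2norm phi)%:C.
by rewrite -[_ +i* 0]/(r%:C) -rmorphM/= lecR ler_pdivrMl.
Qed.

Lemma bijective_resolvent T z (c : R) : 0 < c ->
  (forall psi, c * l2norm psi <= l2norm (T psi - z *: psi)) ->
  (forall phi, exists psi, T psi - z *: psi = phi) -> resolvent_set T z.
Proof.
move=> c0 Tc /choice[S SK].
pose A psi := T psi - z *: psi.
have AD a psi phi : A (a *: psi + phi) = a *: A psi + A phi.
  rewrite /A linearP scalerDr scalerBr !scalerA (mulrC z) opprD.
  by rewrite addrACA.
have AI psi phi : A psi = A phi -> psi = phi.
  move=> e; apply/eqP; rewrite -subr_eq0 -l2norm_eq0 eq_le l2norm_ge0 andbT.
  rewrite -(ler_pM2l c0) mulr0; apply: le_trans (Tc _) _.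
  by rewrite -/(A _) -scaleN1r addrC AD e scaleN1r addNr l2norm0.
have Slin : linear S.
  by move=> a psi phi; apply: (AI); rewrite AD /A !SK.
pose S' : {linear l2 R -> l2 R} := HB.pack S (GRing.isLinear.Build _ _ _ _ S Slin).
exists S'; split; last 2 first.
- by move=> psi; apply: (AI); rewrite [LHS]SK.
- by move=> psi; exact: SK.
apply/linear_bounded_continuous/linear_boundedP; near=> r => psi.
apply: (@le_trans _ _ ((c^-1)%:C * `|psi|)); last first.
  rewrite ler_wpM2r//; near: r; apply: nbhs_pinfty_ge.
  by rewrite complex_real.
rewrite -[`|psi|]/(l2norm psi)%:C -[`|_|]/(l2norm (S psi))%:C -rmorphM/= lecR.
by rewrite ler_pdivlMl//; apply: le_trans (Tc _) _; rewrite SK.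
Unshelve. all: by end_near. Qed.

End resolvent_bounds.

Section walk_resolvent.
Context {R : realType} (C : int -> 'M[R[i]]_2).
Context (unitC : forall x, C x \is unitarymx).
Implicit Types (psi phi : l2 R) (z : R[i]).

Lemma mul2E (A : 'M[R[i]]_2) (v : 'cV[R[i]]_2) j :
  (A *m v) j 0 = A j 0 * v 0 0 + A j 1 * v 1 0.
Proof.
rewrite mxE !big_ord_recl big_ord0 addr0.
by congr (_ + A j _ * v _ _); apply: val_inj.
Qed.

Lemma walk0E psi x : walk unitC psi x 0 0 =
  C (x + 1) 0 0 * psi (x + 1) 0 0 + C (x + 1) 0 1 * psi (x + 1) 1 0.
Proof. by rewrite -mul2E mxE. Qed.

Lemma walk1E psi x : walk unitC psi x 1 0 =
  C (x - 1) 1 0 * psi (x - 1) 0 0 + C (x - 1) 1 1 * psi (x - 1) 1 0.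
Proof. by rewrite -mul2E mxE. Qed.

Lemma l2norm_walk psi : l2norm (walk unitC psi) = l2norm psi.
Proof.
by rewrite /l2norm /walk/= [X in fine X]l2mass_shift [X in fine X]l2mass_coin.
Qed.

Lemma sqn_shift (phi : int -> 'cV[R[i]]_2) x :
  sqn (shift_fun phi x) <= sqn (phi (x + 1)) + sqn (phi (x - 1)).
Proof.
rewrite !sqnE !mxE /= addrACA lerD// ?lerDl ?lerDr ?sqr_ge0//.
Qed.

Lemma sqn_walk_le psi x :
  sqn (walk unitC psi x) <= sqn (psi (x + 1)) + sqn (psi (x - 1)).
Proof.
by apply: le_trans (sqn_shift _ _) _; rewrite /= /coin_fun !sqn_unitary.
Qed.

Lemma finite_range_walk : finite_range (walk unitC).
Proof.
move=> x; exists [:: x + 1; x - 1], 1; split=> // psi.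
by rewrite !big_cons big_nil addr0 mul1r; exact: sqn_walk_le.
Qed.

(** This is [C^* S^-1], the inverse of [U = S C]. *)
Definition walk_inv_fun (phi : int -> 'cV[R[i]]_2) : int -> 'cV[R[i]]_2 :=
  fun x => (C x)^t* *m \col_j (if j == 0 then phi (x - 1) 0 0 else phi (x + 1) 1 0).

Lemma walk_inv_funK phi : shift_fun (coin_fun C (walk_inv_fun phi)) = phi.
Proof.
apply/funext => x; rewrite /coin_fun /walk_inv_fun.
have CK y (v : 'cV[R[i]]_2) : C y *m ((C y)^t* *m v) = v.
  by rewrite mulmxA (unitarymxP (unitC y)) mul1mx.
apply/colP => j; rewrite mxE !CK !mxE /=.
case: (unliftP 0 j) => [k|] -> /=; last by rewrite addrK.
by rewrite subrK; congr (phi x _ 0); apply: val_inj => /=; case: k => -[].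
Qed.

Lemma l2mass_walk_inv phi : l2mass (walk_inv_fun phi) = l2mass phi.
Proof. by rewrite -{2}(walk_inv_funK phi) l2mass_shift l2mass_coin. Qed.

Fact walk_inv_subproof phi : walk_inv_fun phi \in square_summable.
Proof. by rewrite square_summableE l2mass_walk_inv l2mass_fin. Qed.

Definition walk_inv phi : l2 R := L2 (walk_inv_subproof phi).

Fact walk_inv_linear : linear walk_inv.
Proof.
move=> a psi phi; apply/val_inj/funext => x /=.
rewrite -[RHS]/(a *: walk_inv_fun psi x + walk_inv_fun phi x).
rewrite /walk_inv_fun scalemxAr -mulmxDr; congr (_ *m _).
by apply/colP => j; rewrite !mxE; case: ifP.
Qed.

HB.instance Definition _ :=
  GRing.isLinear.Build R[i] (l2 R) (l2 R) _ walk_inv walk_inv_linear.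

Lemma walk_invK phi : walk unitC (walk_inv phi) = phi.
Proof. by apply/val_inj; exact: walk_inv_funK. Qed.

Lemma l2norm_walk_inv phi : l2norm (walk_inv phi) = l2norm phi.
Proof. by rewrite -{2}(walk_invK phi) l2norm_walk. Qed.

Lemma finite_range_walk_inv : finite_range walk_inv.
Proof.
move=> x; exists [:: x - 1; x + 1], 1; split=> // psi.
rewrite !big_cons big_nil addr0 mul1r /= /walk_inv_fun sqn_unitary; last first.
  by rewrite trmxC_unitary.
by rewrite !sqnE !mxE /= addrACA lerD// ?lerDl ?lerDr ?sqr_ge0//.
Qed.

End walk_resolvent.

Section walk_bounded_below.
Context {R : realType} (C : int -> 'M[R[i]]_2).
Context (unitC : forall x, C x \is unitarymx).
Implicit Types (psi phi : l2 R) (z : R[i]).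
Local Notation U := (walk unitC).

(* For |z| = 1 and V = z^-1 U, the operator (1 + V) / 2 is a strict contraction
   as soon as 1 - V is bounded below, by the parallelogram identity. *)
Lemma walk_solvable_unit z (c : R) phi : normc z = 1 -> 0 < c ->
  (forall psi, c * l2norm psi <= l2norm (U psi - z *: psi)) ->
  exists psi, U psi - z *: psi = phi.
Proof.
move=> z1 c0 Uc.
have z0 : z != 0.
  by apply/eqP => ze; move: z1; rewrite ze normc0 => /esym/eqP; rewrite oner_eq0.
(* The parallelogram identity bounds the squared norm of [(1 + V) / 2] by [1 - d ^+ 2 / 4]; capping
   at 1 keeps this nonnegative. *)
pose d := Num.min c 1.
have d0 : 0 < d by rewrite lt_min c0 ltr01.
have d1 : d <= 1 by rewrite ge_min lexx orbT.
have Ud psi : d * l2norm psi <= l2norm (U psi - z *: psi).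
  apply: le_trans (Uc psi); rewrite ler_wpM2r ?l2norm_ge0//.
  by rewrite ge_min lexx.
pose T : {linear l2 R -> l2 R} := 2^-1 \*: (idfun \+ z^-1 \*: U).
have Tf : finite_range T.
  apply/finite_rangeZ/finite_rangeD; first exact: finite_range_id.
  exact/finite_rangeZ/finite_range_walk.
have r01 : 0 <= 1 - d ^+ 2 / 4 by nra.
have Tlt1 : 0 <= Num.sqrt (1 - d ^+ 2 / 4) < 1.
  rewrite sqrtr_ge0/= -[ltRHS]sqrtr1 ltr_sqrt ?ltr01// gtrDl oppr_lt0.
  by rewrite divr_gt0 ?exprn_gt0.
have Tle f : l2norm (T f) <= Num.sqrt (1 - d ^+ 2 / 4) * l2norm f.
  rewrite -(@ler_pXn2r _ 2)// ?nnegrE ?mulr_ge0 ?l2norm_ge0 ?sqrtr_ge0//.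
  rewrite exprMn [X in _ <= X * _]sqr_sqrtr//.
  have -> : T f = 2^-1 *: (f + z^-1 *: U f) by [].
  have := l2norm_parallelogram f (z^-1 *: U f).
  have -> : l2norm (f - z^-1 *: U f) = l2norm (U f - z *: f).
    have -> : f - z^-1 *: U f = - z^-1 *: (U f - z *: f).
      by rewrite scalerBr scaleNr scalerA mulNr mulVf// scaleN1r opprK addrC.
    by rewrite l2normZ normcN normcV z1 invr1 mul1r.
  rewrite !l2normZ normcV z1 invr1 mul1r l2norm_walk.
  rewrite exprMn normcV.
  have -> : normc (2 : R[i]) = 2.
    by rewrite (_ : 2 = (2 : R)%:C) ?normc_real ?ger0_norm// rmorphD.
  have : (d * l2norm f) ^+ 2 <= l2norm (U f - z *: f) ^+ 2.
    by rewrite ler_pXn2r ?nnegrE ?mulr_ge0 ?l2norm_ge0// ltW.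
  move: (l2norm (_ - _)) (l2norm (_ + _)) (l2norm f) => a b e; rewrite exprMn.
  have -> : (2^-1 : R) ^+ 2 = 1 / 4 by field.
  move: (d ^+ 2) => d2; nra.
have [psi psiE] := neumann (- (2 * z)^-1 *: phi) Tf Tlt1 Tle.
exists psi; have -> : U psi - z *: psi = - (2 * z) *: (psi - T psi).
  have -> : T psi = 2^-1 *: (psi + z^-1 *: U psi) by [].
  have half : 1 - 2^-1 = 2^-1 :> R[i] by field.
  have -> : psi - 2^-1 *: (psi + z^-1 *: U psi) = 2^-1 *: (psi - z^-1 *: U psi).
    by rewrite (scalerDr 2^-1) opprD addrA -[X in X - _ - _]scale1r -scalerBl half scalerBr.
  rewrite scalerA.
  have -> : - (2 * z) / 2 = - z by field.
  by rewrite scalerBr scalerA mulNr divff// scaleN1r opprK addrC scaleNr.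
rewrite psiE scalerA mulrNN divff ?scale1r//.
by rewrite mulf_neq0// pnatr_eq0.
Qed.

Lemma normc_neq1_bounded_below z psi :
  `|1 - normc z| * l2norm psi <= l2norm (U psi - z *: psi).
Proof.
have h1 := l2norm_sub_ge (U psi) (z *: psi).
have h2 := l2norm_sub_ge (z *: psi) (U psi).
move: h1 h2; rewrite [X in _ -> _ <= X -> _]l2norm_distC l2normZ l2norm_walk.
move=> h1 h2; rewrite -[X in `|_| * X](ger0_norm (l2norm_ge0 psi)) -normrM.
by rewrite ler_norml mulrBl mul1r; apply/andP; split; lra.
Qed.

(** Surjectivity follows from the lower bound: [U - z] is [U (1 - z U^-1)] inside the unit circle
    and [- z (1 - z^-1 U)] outside, both inverted by Neumann series, and on the circle the averaging
    argument applies. *)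
Lemma walk_resolvent_bounded_below z (c : R) : 0 < c ->
  (forall psi, c * l2norm psi <= l2norm (U psi - z *: psi)) -> resolvent_set U z.
Proof.
move=> c0 Uc; apply: (bijective_resolvent c0 Uc) => phi.
have [z1|z1|z1] := ltrgtP (normc z) 1; last exact: walk_solvable_unit c0 Uc.
- pose T : {linear l2 R -> l2 R} := z \*: walk_inv unitC.
  have Tf : finite_range T by exact/finite_rangeZ/finite_range_walk_inv.
  have Tlt1 : 0 <= normc z < 1 by rewrite normc_ge0.
  have Tle f : l2norm (T f) <= normc z * l2norm f.
    by rewrite [X in l2norm X]/= l2normZ l2norm_walk_inv.
  have [psi psiE] := neumann (walk_inv unitC phi) Tf Tlt1 Tle.
  exists psi; have := congr1 U psiE; rewrite linearB walk_invK => <-.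
  congr (_ - _); have -> : T psi = z *: walk_inv unitC psi by [].
  by rewrite linearZ walk_invK.
- have zn0 : z != 0.
    by apply/eqP => ze; move: z1; rewrite ze normc0 ltr10.
  pose T : {linear l2 R -> l2 R} := z^-1 \*: U.
  have Tf : finite_range T by exact/finite_rangeZ/finite_range_walk.
  have Tlt1 : 0 <= (normc z)^-1 < 1.
    by rewrite invr_ge0 normc_ge0/= invf_lt1// (lt_trans ltr01).
  have Tle f : l2norm (T f) <= (normc z)^-1 * l2norm f.
    by rewrite [X in l2norm X]/= l2normZ normcV l2norm_walk.
  have [psi psiE] := neumann (- z^-1 *: phi) Tf Tlt1 Tle.
  exists psi; have -> : U psi - z *: psi = - z *: (psi - T psi).
    have -> : T psi = z^-1 *: U psi by [].
    by rewrite scalerBr scalerA mulNr divff// scaleN1r opprK addrC scaleNr.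
  by rewrite psiE scalerA mulrNN divff ?scale1r.
Qed.

Lemma spectrum_unit z : spectrum U z -> normc z = 1.
Proof.
move=> Uz; apply/eqP/negPn/negP => z1; apply: Uz.
apply: (@walk_resolvent_bounded_below _ `|1 - normc z|) => [|psi].
  by rewrite normr_gt0 subr_eq0 eq_sym.
exact: normc_neq1_bounded_below.
Qed.

End walk_bounded_below.

(** * The constant coin and points outside the arcs *)

Section constant_coin.
Context {R : realType} (K : 'M[R[i]]_2).
Context (unitK : forall x : int, (fun=> K) x \is unitarymx).
Implicit Types (psi phi : l2 R) (z : R[i]).
Local Notation W := (walk unitK).
Local Notation D := (K 0 0 * K 1 1 - K 0 1 * K 1 0).

Lemma l2mass_translate (k : int) psi : l2mass (fun x => psi (x + k)) = l2mass psi.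
Proof.
rewrite /l2mass [RHS](@reindex_esum _ _ _ setT setT (fun x => x + k))//.
by split => // [x y _ _ /addIr //|y _]; exists (y - k) => //; rewrite subrK.
Qed.

Fact translate_subproof (k : int) psi : (fun x => psi (x + k)) \in square_summable.
Proof. by rewrite square_summableE l2mass_translate l2mass_fin. Qed.

Definition translate k psi : l2 R := L2 (translate_subproof k psi).

Lemma l2norm_translate k psi : l2norm (translate k psi) = l2norm psi.
Proof. by rewrite /l2norm l2mass_translate. Qed.

(* Cayley-Hamilton for the symbol of W, whose trace is K00 e^{ik} + K11 e^{-ik}
   and whose determinant is det K. *)
Lemma constant_walk_sqr psi : W (W psi) + D *: psi =
  K 0 0 *: translate 1 (W psi) + K 1 1 *: translate (- 1) (W psi).
Proof.
apply/val_inj/funext => x; apply/colP => j.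
have addl2 (f g : l2 R) y i : (f + g : l2 R) y i 0 = f y i 0 + g y i 0.
  by rewrite [LHS]mxE.
have mull2 (a : R[i]) (f : l2 R) y i : (a *: f : l2 R) y i 0 = a * f y i 0.
  by rewrite [LHS]mxE.
have trE k (f : l2 R) y i : translate k f y i 0 = f (y + k) i 0 by [].
rewrite !addl2 !mull2 !trE.
case: (unliftP 0 j) => [k ->|->].
  have -> : lift 0 k = 1 :> 'I_2 by apply: val_inj; case: k => -[].
  by rewrite !walk1E !walk0E !subrK !addrK; ring.
by rewrite !walk0E !walk1E !subrK !addrK; ring.
Qed.

(** The cofactor [W - D / z] turns [W - z] into [W^2 + D - (z + D / z) W], which by Cayley-Hamilton
    is a combination of translations minus a scalar, applied to the isometry [W]. The factor on the
    right bounds the norm of the cofactor. *)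
Lemma constant_walk_bounded_below z psi : z != 0 ->
  (normc (z + D / z) - normc (K 0 0) - normc (K 1 1)) * l2norm psi <=
  (1 + normc (D / z)) * l2norm (W psi - z *: psi).
Proof.
move=> z0; set w := D / z.
have E : W (W psi - z *: psi) - w *: (W psi - z *: psi) =
    W (W psi) + D *: psi - (z + w) *: W psi.
  have -> : D = w * z by rewrite /w divfK.
  rewrite linearB linearZ/= scalerBr scalerA scalerDl.
  move: (W (W psi)) (W psi) => A B; rewrite [in RHS]opprD [in LHS]opprB.
  by rewrite addrACA.
have le1 : l2norm (W (W psi - z *: psi) - w *: (W psi - z *: psi)) <=
    (1 + normc w) * l2norm (W psi - z *: psi).
  apply: le_trans (ler_l2normD _ _) _.
  by rewrite l2normN l2normZ l2norm_walk mulrDl mul1r.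
apply: le_trans le1; rewrite E l2norm_distC; apply: le_trans (l2norm_sub_ge _ _).
rewrite l2normZ l2norm_walk constant_walk_sqr !mulrBl -addrA -opprD lerD2l lerN2.
apply: le_trans (ler_l2normD _ _) _.
by rewrite !l2normZ !l2norm_translate !l2norm_walk.
Qed.

End constant_coin.

(** * Lower bounds up to finitely many sites *)

Section coercive_modulo_finite.
Context {R : realType}.
Implicit Types (S T : {linear l2 R -> l2 R}) (psi phi : l2 R).

(** A semi-Fredholm estimate whose compact term is the restriction to the finite set [s]. *)
Definition coercive_mod_finite (S : l2 R -> l2 R) := exists (s : seq int) (L : R),
  0 < L /\ forall psi,
    l2norm psi ^+ 2 <= L * (l2norm (S psi) ^+ 2 + \sum_(x <- s) sqn (psi x)).

Lemma sum_seq_le (s : seq int) (F : int -> R) e :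
  (forall x, x \in s -> F x <= e) -> \sum_(x <- s) F x <= (size s)%:R * e.
Proof.
move=> Fe; rewrite mulr_natl -[leRHS]addr0 -iter_addr -count_predT -big_const_seq.
by rewrite big_seq [leRHS]big_seq; apply: ler_sum.
Qed.

Lemma natSinv_small (e : R) : 0 < e ->
  exists N, forall n, (N <= n)%N -> n.+1%:R^-1 < e.
Proof.
by move=> e0; have [N _ NP] := near_infty_natSinv_lt (PosNum e0); exists N.
Qed.

Lemma sqr_le_add2 (a b c : R) : 0 <= a -> 0 <= b -> 0 <= c -> a <= b + c ->
  a ^+ 2 <= 2 * b ^+ 2 + 2 * c ^+ 2.
Proof.
move=> a0 b0 c0 abc; have : a ^+ 2 <= (b + c) ^+ 2.
  by apply: lerXn2r; rewrite ?nnegrE ?addr_ge0.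
by have := sqr_ge0 (b - c); nra.
Qed.

Lemma absorb_half (L a x y t : R) : 0 < L -> a <= L * (t + y) ->
  t <= 2 * x + 2 * (1 / (4 * L) * a) -> 0 <= y -> a <= 4 * L * (x + y).
Proof.
move=> L0 aL th y0; have := ler_wpM2l (ltW L0) th; have := mulr_ge0 (ltW L0) y0.
have -> : L * (2 * x + 2 * (1 / (4 * L) * a)) = 2 * (L * x) + a / 2.
  by field; rewrite gt_eqF.
by move: aL; rewrite !mulrDr -!mulrA; move: (L * x) (L * y) (L * t) => *; lra.
Qed.

(** Finite range puts the weak limit [psi] in the kernel of [S]. Coercivity applied to [u n - psi]
    then upgrades sitewise to norm convergence, since [S (u n - psi) = S (u n)] is small and so is
    the mass on [s]. *)
Lemma coercive_compact S (u : nat -> l2 R) (B : R) :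
  finite_range S -> coercive_mod_finite S ->
  (forall n, l2norm (u n) <= B) ->
  (forall e : R, 0 < e -> exists N, forall n, (N <= n)%N -> l2norm (S (u n)) ^+ 2 < e) ->
  exists2 psi, S psi = 0 &
    forall e N, 0 < e -> exists2 n, (N <= n)%N & l2norm (u n - psi) ^+ 2 < e.
Proof.
move=> Sf [s [L [L0 SL]]] uB Su; have [psi psiP] := weak_compact uB.
have Spsi : S psi = 0.
  apply/val_inj/funext => x /=; apply/sqn_eq0/eqP.
  rewrite eq_le sqn_ge0 andbT; have [t [K [K0 SK]]] := Sf x.
  apply: (@le0_small _ _ (2 * (K * (size t)%:R) + 2)) => e e0.
  have [N NP] := Su e e0; have [n Nn nP] := psiP t e N e0.
  pose d : l2 R := psi - u n.
  have Sd : sqn (S d x) <= K * ((size t)%:R * e).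
    apply: le_trans (SK d) _; rewrite ler_wpM2l//; apply: sum_seq_le => y ys.
    by rewrite -sqnN opprB; exact/ltW/nP.
  have Sun : sqn (S (u n) x) <= e by apply: le_trans (sqn_le_l2norm _ _) (ltW (NP n Nn)).
  have -> : S psi x = S d x + S (u n) x.
    by rewrite /d linearB/= addrNK.
  apply: le_trans (sqn_add2 _ _) _.
  by move: Sd Sun; rewrite mulrA; move: (K * _) (sqn _) (sqn _) => K' a b; lra.
exists psi => // e N e0.
pose e' := e / (L * (1 + (size s)%:R) * 2).
have s0 : 0 < 1 + (size s)%:R :> R by rewrite ltr_pwDl.
have e'0 : 0 < e' by rewrite divr_gt0 ?mulr_gt0.
have [M MP] := Su e' e'0; have [n Nn nP] := psiP s e' (maxn N M) e'0.
move: Nn; rewrite geq_max => /andP[Nn Mn]; exists n => //.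
apply: le_lt_trans (SL _) _; rewrite linearB Spsi subr0.
have h : \sum_(x <- s) sqn ((u n - psi) x) <= (size s)%:R * e'.
  by apply: sum_seq_le => x xs; exact/ltW/nP.
apply: (@le_lt_trans _ _ (L * (e' + (size s)%:R * e'))).
  by apply: ler_wpM2l; [exact: ltW|apply: lerD => //; exact/ltW/MP].
have -> : L * (e' + (size s)%:R * e') = e / 2.
  by rewrite /e'; field; rewrite !gt_eqF.
by rewrite gtr_pMr// invf_lt1// ltr1n.
Qed.

End coercive_modulo_finite.

(** * Coercive spectral points are isolated eigenvalues *)

Section discrete_points.
Context {R : realType} (C : int -> 'M[R[i]]_2).
Context (unitC : forall x, C x \is unitarymx).
Implicit Types (psi phi : l2 R) (z w : R[i]).
Local Notation U := (walk unitC).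

Definition walk_sub z : {linear l2 R -> l2 R} := U \+ (- z) \*: idfun.

Lemma walk_subE z psi : walk_sub z psi = U psi - z *: psi.
Proof. by rewrite -scaleNr. Qed.

Lemma finite_range_walk_sub z : finite_range (walk_sub z).
Proof.
apply: finite_rangeD; first exact: finite_range_walk.
exact/finite_rangeZ/finite_range_id.
Qed.

Lemma coercive_near z : coercive_mod_finite (walk_sub z) ->
  exists2 r : R, 0 < r & forall w, normc (w - z) < r ->
    coercive_mod_finite (walk_sub w).
Proof.
move=> [s [L [L0 zL]]].
have L4 : 0 < 1 / (4 * L) by rewrite divr_gt0 ?mulr_gt0.
(* With this radius the change from [z] to [w] costs at most half of [l2norm psi ^+ 2], which the
   left side absorbs. *)
exists (Num.sqrt (1 / (4 * L))); first by rewrite sqrtr_gt0.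
move=> w wz; exists s, (4 * L); split; first by rewrite mulr_gt0.
move=> psi.
have h1 : l2norm (walk_sub z psi) <=
    l2norm (walk_sub w psi) + normc (w - z) * l2norm psi.
  rewrite -l2normZ; apply: le_trans (ler_l2normD _ _).
  by rewrite !walk_subE scalerBl addrA subrK.
have h2 : normc (w - z) ^+ 2 <= 1 / (4 * L).
  rewrite -[leRHS]sqr_sqrtr; last exact: ltW.
  by apply: lerXn2r; rewrite ?nnegrE ?normc_ge0 ?sqrtr_ge0// ltW.
have S0 : 0 <= \sum_(x <- s) sqn (psi x) by apply: sumr_ge0 => *; exact: sqn_ge0.
have n0 := l2norm_ge0 (walk_sub z psi); have m0 := l2norm_ge0 (walk_sub w psi).
have h3 : l2norm (walk_sub z psi) ^+ 2 <=
    2 * l2norm (walk_sub w psi) ^+ 2 + 2 * (1 / (4 * L) * l2norm psi ^+ 2).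
  have d0 : 0 <= normc (w - z) * l2norm psi.
    by rewrite mulr_ge0 ?normc_ge0 ?l2norm_ge0.
  apply: (le_trans (sqr_le_add2 n0 m0 d0 h1)).
  by rewrite lerD2l ler_pM2l// exprMn ler_wpM2r ?sqr_ge0.
exact: (absorb_half L0 (zL psi) h3 S0).
Qed.

Lemma walk_eigen_normalized z : is_eigenvalue U z ->
  exists2 psi, l2norm psi = 1 & U psi = z *: psi.
Proof.
move=> [f f0 Uf]; have n0 : 0 < l2norm f by rewrite l2norm_gt0.
exists ((l2norm f)^-1%:C *: f).
  by rewrite l2normZ normc_real gtr0_norm ?invr_gt0// mulVf// gt_eqF.
by rewrite linearZ Uf [LHS]scalerA [RHS]scalerA mulrC.
Qed.

(** A spectral point admits no lower bound, hence has approximate eigenvectors of norm 1; coercivity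
    makes some of them approach a genuine solution in norm, which cannot be 0. *)
Lemma coercive_eigenvalue z : coercive_mod_finite (walk_sub z) ->
  spectrum U z -> is_eigenvalue U z.
Proof.
move=> zc Uz.
have : forall n : nat, exists psi, l2norm psi = 1 /\
    l2norm (walk_sub z psi) <= n.+1%:R^-1.
  move=> n; apply: contrapT => /forallNP nP; apply: Uz.
  apply: (@walk_resolvent_bounded_below _ _ unitC z n.+1%:R^-1) => [|psi].
    by rewrite invr_gt0 ltr0Sn.
  have [->|psi0] := eqVneq psi 0; first by rewrite l2norm0 mulr0 l2norm_ge0.
  have p0 : 0 < l2norm psi by rewrite l2norm_gt0.
  rewrite leNgt; apply/negP => lt1; apply: (nP ((l2norm psi)^-1%:C *: psi)).
  have nE : normc ((l2norm psi)^-1%:C) = (l2norm psi)^-1.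
    by rewrite normc_real gtr0_norm ?invr_gt0.
  split; first by rewrite l2normZ nE mulVf// gt_eqF.
  rewrite linearZ l2normZ nE -ler_pdivlMl ?invr_gt0// invrK mulrC walk_subE.
  exact: ltW.
move=> /choice[u uP].
have uB n : l2norm (u n) <= 1 by rewrite (uP n).1.
have Su e : 0 < e ->
    exists N, forall n, (N <= n)%N -> l2norm (walk_sub z (u n)) ^+ 2 < e.
  move=> e0; have [N NP] := natSinv_small e0; exists N => n Nn.
  apply: le_lt_trans (NP n Nn); rewrite -[leRHS]mulr1 expr2.
  by rewrite ler_pM ?l2norm_ge0 ?(uP n).2// (le_trans (uP n).2)// invf_le1 ?ler1n.
have [psi Upsi psiP] := coercive_compact (finite_range_walk_sub z) zc uB Su.
exists psi; last by apply/eqP; rewrite -subr_eq0 -walk_subE Upsi.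
apply/eqP => psi0; have [n _] := psiP 1 0%N ltr01.
by rewrite psi0 subr0 (uP n).1 expr1n ltxx.
Qed.

(** The real pairing [h] of [f] with [b *: g] is additive in [b] by Fréchet's identity, and
    invariant under [b |-> z / w * b] because [U] is an isometry. So it vanishes on all multiples of
    [1 - z / w], which is nonzero; in particular at [-1]. *)
Lemma eigen_orthogonal w z f g : normc w = 1 -> normc z = 1 -> w != z ->
  U f = w *: f -> U g = z *: g ->
  l2norm (f - g) ^+ 2 = l2norm f ^+ 2 + l2norm g ^+ 2.
Proof.
move=> w1 z1 wz Uf Ug.
have w0 : w != 0.
  by apply/eqP => we; move: w1; rewrite we normc0 => /esym/eqP; rewrite oner_eq0.
have lin1 (A F G H P Q S : R) : A + (F + (G + H)) = P + (Q + S) ->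
  A - F - Q = (P - F - G) + (S - F - H) by move=> ?; lra.
(* Re <f, b g>, up to a factor 2 *)
pose h (b : R[i]) := l2norm (f + b *: g) ^+ 2 - l2norm f ^+ 2 - l2norm (b *: g) ^+ 2.
have hD a b : h (a + b) = h a + h b.
  have := l2norm_triple f (a *: g) (b *: g).
  by rewrite -addrA -scalerDl => /lin1.
have h0 : h 0 = 0 by rewrite /h scale0r addr0 l2norm0 expr0n subrr subr0.
have hZ b : h (z / w * b) = h b.
  have e1 : l2norm ((z / w * b) *: g) = l2norm (b *: g).
    by rewrite !l2normZ normcM normcM normcV w1 z1 invr1 !mul1r.
  have UE : U (f + b *: g) = w *: (f + (z / w * b) *: g).
    rewrite linearD linearZ Uf Ug [X in _ + X]scalerA scalerDr [in RHS]scalerA.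
    by congr (_ + _ *: _); field.
  have e2 : l2norm (f + (z / w * b) *: g) = l2norm (f + b *: g).
    by rewrite -[RHS](l2norm_walk unitC) UE [RHS]l2normZ w1 mul1r.
  by rewrite /h e1 e2.
have hN b : h (- b) = - h b.
  by apply/eqP; rewrite -subr_eq0 opprK -hD addNr h0.
have lam : 1 - z / w != 0.
  by rewrite subr_eq0 eq_sym; apply: contra wz => /eqP e; rewrite -[z](divfK w0) e mul1r.
have : h (- 1) = 0.
  have -> : - 1 = - (1 - z / w)^-1 + z / w * (1 - z / w)^-1.
    by move: (z / w) lam => l l1; field.
  by rewrite hD hZ hN addNr.
rewrite /h scaleN1r l2normN => /eqP; rewrite subr_eq add0r subr_eq => /eqP ->.
exact: addrC.
Qed.

(** Otherwise eigenvalues other than [z] accumulate at [z], with unit eigenvectors approaching some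
    [psi] in the eigenspace of [z]. By orthogonality their squared distance to [psi] is at least
    1. *)
Lemma coercive_isolated z : coercive_mod_finite (walk_sub z) ->
  spectrum U z -> isolated (spectrum U) z.
Proof.
move=> zc Uz; split; first exact: mem_set.
have [r r0 rP] := coercive_near zc.
apply: contrapT => niso.
have : forall n : nat, exists p : R[i] * l2 R, [/\ normc (p.1 - z) <= n.+1%:R^-1,
    p.1 != z, normc p.1 = 1, l2norm p.2 = 1 & U p.2 = p.1 *: p.2].
  move=> n; apply: contrapT => nP; apply: niso.
  pose e := Num.min r n.+1%:R^-1.
  have e0 : 0 < e by rewrite lt_min r0 invr_gt0 ltr0Sn.
  exists (ball (z : R[i]^o) e%:C); first by apply: nbhsx_ballx; rewrite ltcR.
  apply/seteqP; split => [w [/= zw Uw]|w /= ->]; last first.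
    by split=> //; apply: ballxx; rewrite ltcR.
  apply: contrapT => /eqP wz; apply: nP.
  have wze : normc (w - z) < e by rewrite normc_distC -ltcR.
  have wzr : normc (w - z) < r by apply: lt_le_trans wze _; rewrite ge_min lexx.
  have [psi psi1 Upsi] := walk_eigen_normalized (coercive_eigenvalue (rP w wzr) Uw).
  exists (w, psi); split=> //=; last exact: (spectrum_unit Uw).
  by apply: ltW; apply: lt_le_trans wze _; rewrite ge_min lexx orbT.
move=> /choice[p pP].
pose u n := (p n).2.
have uB n : l2norm (u n) <= 1 by have [] := pP n; rewrite /u => _ _ _ ->.
have Su e : 0 < e ->
    exists N, forall n, (N <= n)%N -> l2norm (walk_sub z (u n)) ^+ 2 < e.
  move=> e0; have [N NP] := natSinv_small e0; exists N => n Nn.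
  have [pz _ _ u1 Uu] := pP n.
  rewrite walk_subE /u Uu -scalerBl l2normZ u1 mulr1.
  apply: le_lt_trans (NP n Nn); rewrite -[leRHS]mulr1 expr2.
  by rewrite ler_pM ?normc_ge0// (le_trans pz)// invf_le1 ?ler1n.
have [psi Upsi psiP] := coercive_compact (finite_range_walk_sub z) zc uB Su.
have [n _] := psiP 1 0%N ltr01; apply/negP; rewrite -leNgt.
have [_ pz p1 u1 Uu] := pP n.
rewrite (eigen_orthogonal p1 (spectrum_unit Uz) pz Uu).
  by rewrite /u u1 expr1n lerDl sqr_ge0.
by apply/eqP; rewrite -subr_eq0 -walk_subE Upsi.
Qed.

End discrete_points.

(** * Perturbation of a constant walk *)

Section asymptotically_constant.
Context {R : realType} (C : int -> 'M[R[i]]_2) (K : 'M[R[i]]_2).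
Context (unitC : forall x, C x \is unitarymx).
Context (unitK : forall x : int, (fun=> K) x \is unitarymx).
Implicit Types (psi phi : l2 R) (z : R[i]).
Local Notation U := (walk unitC).
Local Notation W := (walk unitK).

Lemma sqn_mulmx_le (A : 'M[R[i]]_2) (v : 'cV[R[i]]_2) (e : R) :
  (forall j k, normc (A j k) <= e) -> sqn (A *m v) <= 4 * e ^+ 2 * sqn v.
Proof.
move=> Ae; have e0 : 0 <= e by apply: le_trans (Ae 0 0); exact: normc_ge0.
have row j : normc ((A *m v) j 0) ^+ 2 <= 2 * e ^+ 2 * sqn v.
  rewrite mul2E sqnE.
  apply: (@le_trans _ _ ((e * normc (v 0 0) + e * normc (v 1 0)) ^+ 2)).
    apply: lerXn2r; rewrite ?nnegrE ?addr_ge0 ?mulr_ge0 ?normc_ge0//.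
    apply: le_trans (le_normcD _ _) _.
    by rewrite !normcM lerD// ler_wpM2r ?normc_ge0.
  move: (normc _) (normc _) => a b.
  have := mulr_ge0 (sqr_ge0 e) (sqr_ge0 (a - b)); lra.
rewrite [leLHS]sqnE; have := row 0; have := row 1; lra.
Qed.

Lemma walk_coercive z (c : R) :
  (forall e : R, 0 < e -> exists2 s : seq int, uniq s &
     forall x, x \notin s -> forall j k, normc (C x j k - K j k) <= e) ->
  0 < c -> (forall psi, c * l2norm psi <= l2norm (W psi - z *: psi)) ->
  coercive_mod_finite (walk_sub unitC z).
Proof.
move=> decay c0 Wc; have c8 : 0 < c / 8 by rewrite divr_gt0.
(* Entries at most [c / 8] give a coin error of at most [4 * (c / 8) ^+ 2 = c ^+ 2 / 16] times the
   mass, small enough to be absorbed; on [s] unitarity of both coins gives the factor 4. *)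
have [s us sP] := decay _ c8; exists s, (16 / c ^+ 2).
split=> [|psi]; first by rewrite divr_gt0 ?exprn_gt0.
have diff : l2norm (U psi - W psi) ^+ 2 <=
    c ^+ 2 / 16 * l2norm psi ^+ 2 + 4 * \sum_(x <- s) sqn (psi x).
  pose f := walk_coin unitC psi - walk_coin unitK psi.
  have -> : U psi - W psi = walk_shift f by rewrite linearB.
  have -> : l2norm (walk_shift f) = l2norm f by rewrite /l2norm [X in fine X]l2mass_shift.
  apply: l2norm_sqr_le => t ut.
  have fE x : f x = (C x - K) *m psi x by rewrite mulmxBl.
  have fx x : sqn (f x) <= c ^+ 2 / 16 * sqn (psi x) +
      4 * (if x \in s then sqn (psi x) else 0).
    have ge0 := sqn_ge0 (psi x); rewrite fE; case: ifPn => xs.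
      rewrite mulmxBl; apply: le_trans (sqn_add2 _ _) _.
      rewrite sqnN sqn_unitary// (sqn_unitary _ (unitK x)).
      have := mulr_ge0 (sqr_ge0 c) ge0; lra.
    have Ae j k : normc ((C x - K) j k) <= c / 8 by rewrite !mxE; exact: sP.
    apply: le_trans (sqn_mulmx_le _ Ae) _; rewrite mulr0 addr0.
    by rewrite le_eqVlt; apply/orP; left; apply/eqP; field.
  apply: le_trans (ler_sum _ (fun x _ => fx x)) _.
  rewrite big_split/= -!mulr_sumr lerD//.
    by rewrite ler_wpM2l ?divr_ge0 ?sqr_ge0//; exact: sum_sqn_le.
  rewrite ler_pM2l// -big_mkcond -big_filter; apply: sum_sub_le => //.
  - exact: filter_uniq.
  - by move=> x; rewrite mem_filter => /andP[].
  - by move=> x; exact: sqn_ge0.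
have tri : c * l2norm psi <= l2norm (walk_sub unitC z psi) + l2norm (U psi - W psi).
  apply: le_trans (Wc psi) _; rewrite [X in _ <= _ + X]l2norm_distC [leRHS]addrC walk_subE.
  apply: le_trans (ler_l2normD _ _).
  by rewrite addrA subrK.
have S0 : 0 <= \sum_(x <- s) sqn (psi x) by apply: sumr_ge0 => *; exact: sqn_ge0.
have := sqr_le_add2 (mulr_ge0 (ltW c0) (l2norm_ge0 psi)) (l2norm_ge0 _) (l2norm_ge0 _) tri.
have aux (A X Y Z : R) : 0 <= X -> 0 <= Y -> Z <= c ^+ 2 / 16 * A + 4 * Y ->
    c ^+ 2 * A <= 2 * X + 2 * Z -> A <= 16 / c ^+ 2 * (X + Y).
  move=> X0 Y0 ZA cA; rewrite mulrAC ler_pdivlMr ?exprn_gt0// mulrC.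
  by move: (c ^+ 2) ZA cA => k; lra.
rewrite exprMn; exact: (aux _ _ _ _ (sqr_ge0 _) S0 diff).
Qed.

End asymptotically_constant.

(** * Transfer recurrence *)

Section transfer.
Context {R : realType} (C : int -> 'M[R[i]]_2).
Context (unitC : forall x, C x \is unitarymx).
Context (C00 : forall x, C x 0 0 != 0).
Implicit Types (psi f g v : l2 R) (z : R[i]).
Local Notation U := (walk unitC).

Lemma l2_scaleE (a : R[i]) f x j : (a *: f : l2 R) x j 0 = a * f x j 0.
Proof. by rewrite [LHS]mxE. Qed.

Lemma l2_subE f g x j : (f - g : l2 R) x j 0 = f x j 0 - g x j 0.
Proof. by rewrite [LHS]mxE [X in _ + X]mxE. Qed.

(** Column 0 and row 1 are unit vectors sharing the entry [A 1 0], so the diagonal entries have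
    equal modulus. The hypothesis on [C x 0 0] thus serves both directions of the recurrence. *)
Lemma unitary_corner (A : 'M[R[i]]_2) : A \is unitarymx -> A 0 0 != 0 -> A 1 1 != 0.
Proof.
move=> uA; apply: contra => /eqP A11.
pose e k : 'cV[R[i]]_2 := \col_i (i == k)%:R.
have /eqP := sqn_unitary (e 0) uA.
have := sqn_unitary (e 1) (_ : A^t* \is unitarymx); rewrite trmxC_unitary => /(_ uA).
rewrite !sqnE !mul2E !mxE /= !mulr0 !mulr1 !(addr0, add0r) A11.
rewrite rmorph0 normc0 !expr0n !expr1n /= !(addr0, add0r) sqrtr0 sqrtr1 expr0n expr1n /=.
rewrite !(addr0, add0r) -[Num.conj (A 1 0)]/((A 1 0)^*) normc_conj => ->.
by rewrite -subr_eq0 addrK sqrf_eq0 => /eqP/eq0_normc ->.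
Qed.

Lemma eigen_eq0 z psi x : U psi = z *: psi ->
  C x 0 0 * psi x 0 0 + C x 0 1 * psi x 1 0 = z * psi (x - 1) 0 0.
Proof. by move=> Up; rewrite -(l2_scaleE z) -Up walk0E subrK. Qed.

Lemma eigen_eq1 z psi x : U psi = z *: psi ->
  C x 1 0 * psi x 0 0 + C x 1 1 * psi x 1 0 = z * psi (x + 1) 1 0.
Proof. by move=> Up; rewrite -(l2_scaleE z) -Up walk1E addrK. Qed.

(* The recurrence is first order in the pair (psi0 (x - 1), psi1 x). *)
Lemma eigen_state0 z psi x0 : z != 0 -> U psi = z *: psi ->
  psi (x0 - 1) 0 0 = 0 -> psi x0 1 0 = 0 -> psi = 0.
Proof.
move=> z0 Up s0 s1.
pose P x := psi (x - 1) 0 0 = 0 /\ psi x 1 0 = 0.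
have fwd x : P x -> P (x + 1).
  move=> [p0 p1]; have px : psi x 0 0 = 0.
    have := eigen_eq0 x Up; rewrite p0 p1 !mulr0 addr0 => /eqP.
    by rewrite mulf_eq0 (negPf (C00 x)) => /eqP.
  split; first by rewrite addrK.
  have := eigen_eq1 x Up; rewrite px p1 !mulr0 addr0 => /esym/eqP.
  by rewrite mulf_eq0 (negPf z0) => /eqP.
have bwd x : P (x + 1) -> P x.
  rewrite /P addrK => -[p0 p1]; have px : psi x 1 0 = 0.
    have := eigen_eq1 x Up; rewrite p0 p1 !mulr0 add0r => /eqP.
    by rewrite mulf_eq0 (negPf (unitary_corner (unitC x) (C00 x))) => /eqP.
  split=> //; have := eigen_eq0 x Up; rewrite p0 px !mulr0 addr0 => /esym/eqP.
  by rewrite mulf_eq0 (negPf z0) => /eqP.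
have Pn (n : nat) : P (x0 + n%:Z) /\ P (x0 - n%:Z).
  have P0 : P x0 by [].
  have x0D : x0 + 0%N%:Z = x0 by exact: addr0.
  have x0B : x0 - 0%N%:Z = x0 by exact: subr0.
  elim: n => [|n [IH1 IH2]]; first by split; [rewrite x0D|rewrite x0B].
  split; first by rewrite intS addrCA addrC; exact: fwd.
  by apply: bwd; rewrite (_ : _ + 1 = x0 - n%:Z)// intS; ring.
have Px x : P x.
  rewrite -[x](subrK x0) addrC; case: (x - x0) => n; first exact: (Pn n).1.
  by rewrite NegzE; exact: (Pn n.+1).2.
apply/val_inj/funext => x; apply/colP => j; rewrite [RHS]mxE.
case: (unliftP 0 j) => [k ->|->].
  have -> : lift 0 k = 1 :> 'I_2 by apply: val_inj; case: k => -[].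
  exact: (Px x).2.
by have := (Px (x + 1)).1; rewrite addrK.
Qed.

Lemma eigen_linear z (a b : R[i]) u f g : U u = z *: u -> U f = z *: f ->
  U g = z *: g -> U (u - a *: f - b *: g) = z *: (u - a *: f - b *: g).
Proof.
have UB x y : U (x - y) = U x - U y by exact: linearB.
have UZ k x : U (k *: x) = k *: U x by exact: linearZ.
move=> Uu Uf Ug; rewrite !UB !UZ Uu Uf Ug !scalerBr.
by rewrite !scalerA (mulrC a) (mulrC b).
Qed.

(** The state [(p f, q f)] at site 0 embeds the eigenspace into a plane. The three cases are its
    possible ranks 2, 1 and 0; in rank 2 the coefficients come from Cramer's rule. *)
Lemma walk_finite_multiplicity z : z != 0 -> finite_multiplicity U z.
Proof.
move=> z0.
pose p (f : l2 R) := f (0 - 1) 0 0; pose q (f : l2 R) := f 0 1 0.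
have st0 f : U f = z *: f -> p f = 0 -> q f = 0 -> f = 0.
  by move=> Uf; rewrite /p /q => pf qf; exact: (@eigen_state0 z f 0 z0 Uf pf qf).
have pE u a f b g : p (u - a *: f - b *: g) = p u - a * p f - b * p g.
  by rewrite /p !l2_subE !l2_scaleE.
have qE u a f b g : q (u - a *: f - b *: g) = q u - a * q f - b * q g.
  by rewrite /q !l2_subE !l2_scaleE.
have comb u a f b g : U u = z *: u -> U f = z *: f -> U g = z *: g ->
    p u - a * p f - b * p g = 0 -> q u - a * q f - b * q g = 0 ->
    u = a *: f + b *: g.
  move=> Uu Uf Ug pu qu; apply/eqP; rewrite -subr_eq0 opprD addrA; apply/eqP.
  by apply: st0; rewrite ?pE ?qE//; exact: eigen_linear.
have [[f [g [Uf Ug fg]]]|nfg] := pselect (exists f g, [/\ U f = z *: f,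
    U g = z *: g & p f * q g - q f * p g != 0]).
  exists 2%N, (fun i : 'I_2 => if i == 0 then f else g) => v Uv.
  pose a := (p v * q g - q v * p g) / (p f * q g - q f * p g).
  pose b := (p f * q v - q f * p v) / (p f * q g - q f * p g).
  exists (fun i => if i == 0 then a else b).
  rewrite !big_ord_recl big_ord0 addr0 /=.
  by apply: comb => //; rewrite /a /b; field.
have [[f Uf f0]|nf] := pselect (exists2 f, U f = z *: f & f != 0).
  exists 1%N, (fun=> f) => v Uv.
  have W0 : p f * q v = q f * p v.
    apply/eqP; rewrite -subr_eq0; apply/negPn/negP => W0.
    by apply: nfg; exists f, v.
  have sc a : p v = a * p f -> q v = a * q f -> v = \sum_(i < 1) a *: f.
    move=> pv qv; rewrite big_ord1.
    rewrite [LHS](comb v a f 0 f)// ?scale0r ?addr0//.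
      by rewrite pv subrr mul0r subr0.
    by rewrite qv subrr mul0r subr0.
  have [pf0|pf0] := eqVneq (p f) 0.
    have qf0 : q f != 0.
      by apply: contra f0 => /eqP qf0; apply/eqP; exact: st0.
    exists (fun=> q v / q f); apply: sc; last by rewrite divfK.
    move: W0; rewrite pf0 mul0r => /esym/eqP.
    by rewrite mulf_eq0 (negPf qf0)/= mulr0 => /eqP.
  exists (fun=> p v / p f); apply: sc; first by rewrite divfK.
  by rewrite mulrAC (mulrC (p v)) -W0 mulrAC divff ?mul1r.
exists 0%N, (fun=> 0) => v Uv; exists (fun=> 0); rewrite big_ord0.
by apply/eqP/negPn/negP => v0; apply: nf; exists v.
Qed.

End transfer.

(** * Elliptic transfer matrices *)

Section elliptic_transfer.
Context {R : realType}.
Implicit Types (u v w k zeta : R[i]).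

(* Invariant Hermitian form of an elliptic element of SU(1,1); it is definite
   when |w| < |y|. *)
Definition hform (y : R) w u v : R :=
  y * (normc u ^+ 2 + normc v ^+ 2) + 2 * Re ('i * w * v * u^*).

Lemma hform_transfer zeta w u v :
  hform (Im zeta) w (zeta * u - w * v) (zeta^* * v - w^* * u) =
  (normc zeta ^+ 2 - normc w ^+ 2) * hform (Im zeta) w u v.
Proof.
rewrite /hform !sqr_normcE.
case: zeta w u v => [? ?] [? ?] [? ?] [? ?] /=; ring.
Qed.

Lemma hformZ y w k u v : hform y w (k * u) (k * v) = normc k ^+ 2 * hform y w u v.
Proof.
rewrite /hform !sqr_normcE.
case: k w u v => [? ?] [? ?] [? ?] [? ?] /=; ring.
Qed.

Lemma normc_i : normc ('i : R[i]) = 1.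
Proof. by rewrite /= expr0n expr1n add0r sqrtr1. Qed.

Lemma hform_cross w u v : `|2 * Re ('i * w * v * u^*)| <= 2 * (normc w * normc v * normc u).
Proof.
rewrite normrM ger0_norm// ler_pM2l//; apply: le_trans (normc_Re _) _.
by rewrite !normcM normc_i mul1r normc_conj.
Qed.

Lemma hform_ge y w u v :
  (`|y| - normc w) * (normc u ^+ 2 + normc v ^+ 2) <= `|hform y w u v|.
Proof.
have := hform_cross w u v; rewrite /hform.
set c := 2 * Re _; set E := normc u ^+ 2 + _ => hc.
have E0 : 0 <= E by rewrite addr_ge0 ?sqr_ge0.
have wE : 2 * (normc w * normc v * normc u) <= normc w * E.
  have := mulr_ge0 (normc_ge0 w) (sqr_ge0 (normc u - normc v)).
  by rewrite /E; move: (normc u) (normc v) (normc w) => *; lra.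
have := lerB_normD (y * E) c; rewrite normrM (ger0_norm E0).
by rewrite mulrBl; move: wE hc; lra.
Qed.

Lemma hform_le y w u v :
  `|hform y w u v| <= (`|y| + normc w) * (normc u ^+ 2 + normc v ^+ 2).
Proof.
have := hform_cross w u v; rewrite /hform.
set c := 2 * Re _; set E := normc u ^+ 2 + _ => hc.
have E0 : 0 <= E by rewrite addr_ge0 ?sqr_ge0.
have wE : 2 * (normc w * normc v * normc u) <= normc w * E.
  have := mulr_ge0 (normc_ge0 w) (sqr_ge0 (normc u - normc v)).
  by rewrite /E; move: (normc u) (normc v) (normc w) => *; lra.
have := ler_normD (y * E) c; rewrite normrM (ger0_norm E0).
by rewrite mulrDl; move: wE hc; lra.
Qed.

Lemma hform_perturb y w u v u' v' (A d : R) :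
  `|y| <= 1 -> normc w <= 1 ->
  normc u <= A -> normc v <= A -> normc u' <= A -> normc v' <= A ->
  normc (u' - u) <= d -> normc (v' - v) <= d ->
  `|hform y w u' v' - hform y w u v| <= 8 * A * d.
Proof.
move=> y1 w1 uA vA uA' vA' ud vd.
have A0 : 0 <= A := le_trans (normc_ge0 u) uA.
have d0 : 0 <= d := le_trans (normc_ge0 _) ud.
have sq a b : normc a <= A -> normc b <= A -> normc (b - a) <= d ->
    `|normc b ^+ 2 - normc a ^+ 2| <= 2 * A * d.
  move=> aA bA abd; rewrite subr_sqr normrM mulrC.
  apply: ler_pM => //; last first.
    rewrite ler_norml; have := normc_sub_ge b a; have := normc_sub_ge a b.
    by rewrite normc_distC => h1 h2; apply/andP; split; lra.
  by rewrite ger0_norm ?addr_ge0 ?normc_ge0//; lra.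
have -> : hform y w u' v' - hform y w u v =
    y * ((normc u' ^+ 2 - normc u ^+ 2) + (normc v' ^+ 2 - normc v ^+ 2)) +
    2 * Re ('i * w * (v' * (u' - u)^* + (v' - v) * u^*)).
  rewrite /hform.
  move: (normc u' ^+ 2) (normc u ^+ 2) (normc v' ^+ 2) (normc v ^+ 2) => a b c e.
  by case: w u v u' v' {w1 uA vA uA' vA' ud vd} => [? ?] [? ?] [? ?] [? ?] [? ?] /=; ring.
have c1 : `|y * ((normc u' ^+ 2 - normc u ^+ 2) + (normc v' ^+ 2 - normc v ^+ 2))| <= 4 * A * d.
  rewrite normrM; apply: (@le_trans _ _ (1 * (2 * A * d + 2 * A * d))).
    by apply: ler_pM => //; apply: le_trans (ler_normD _ _) _; apply: lerD; exact: sq.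
  by lra.
have c2 : `|2 * Re ('i * w * (v' * (u' - u)^* + (v' - v) * u^*))| <= 4 * A * d.
  rewrite normrM ger0_norm//.
  suff : `|Re ('i * w * (v' * (u' - u)^* + (v' - v) * u^*))| <= 2 * (A * d) by lra.
  apply: le_trans (normc_Re _) _; rewrite !normcM normc_i mul1r.
  rewrite -[leRHS]mul1r; apply: ler_pM; rewrite ?normc_ge0//.
  apply: le_trans (le_normcD _ _) _; rewrite !normcM !normc_conj mulr_natl mulr2n.
  apply: lerD; first by apply: ler_pM; rewrite ?normc_ge0.
  by rewrite mulrC; apply: ler_pM; rewrite ?normc_ge0.
by apply: le_trans (ler_normD _ _) _; lra.
Qed.

(** The relative increments have total at most [e / (1 - r)]. Bounding by [1 - S n], with [S n]
    their partial sum, replaces a product estimate and handles both directions through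
    [(1 - s) (1 - t) >= 1 - s - t] and [(1 - s - t) (1 + t) <= 1 - s]. *)
Lemma slowly_varying_bounds (H : nat -> R) (e r : R) :
  0 <= e -> 0 <= r < 1 -> e / (1 - r) <= 1 / 2 -> (forall n, 0 <= H n) ->
  (forall n, `|H n.+1 - H n| <= e * r ^+ n * H n) ->
  forall n, H 0%N / 2 <= H n /\ H n <= 2 * H 0%N.
Proof.
move=> e0 /andP[r0 r1] er H0 HS.
pose S n := e / (1 - r) * (1 - r ^+ n).
have r1' : 0 < 1 - r by rewrite subr_gt0.
have er0 : 0 <= e / (1 - r) by rewrite divr_ge0// ltW.
have rn n : 0 <= r ^+ n <= 1 by rewrite exprn_ge0//= exprn_ile1// ltW.
have SS n : S n.+1 = S n + e * r ^+ n.
  by rewrite /S exprS; field; rewrite gt_eqF.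
have S0 n : 0 <= S n by rewrite mulr_ge0// subr_ge0; have /andP[] := rn n.
have S1 n : S n <= 1 / 2.
  by apply: le_trans er; rewrite ler_piMr// gerBl; have /andP[] := rn n.
have claim n : (1 - S n) * H 0%N <= H n /\ (1 - S n) * H n <= H 0%N.
  elim: n => [|n [IH1 IH2]]; first by rewrite /S expr0 subrr mulr0 subr0 mul1r.
  have t0 : 0 <= e * r ^+ n by rewrite mulr_ge0//; have /andP[] := rn n.
  move: (S0 n) (S1 n.+1) (HS n) (H0 0%N) (H0 n) (H0 n.+1) IH1 IH2 t0; rewrite SS.
  move: (S n) (e * r ^+ n) (H 0%N) (H n) (H n.+1) => s t h h1 h2.
  rewrite ler_norml => s0 st /andP[l1 l2] h0 h10 h20 i1 i2 t0; split.
    apply: (@le_trans _ _ ((1 - t) * ((1 - s) * h))).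
      by have := mulr_ge0 (mulr_ge0 s0 t0) h0; lra.
    apply: (@le_trans _ _ ((1 - t) * h1)); last by lra.
    by rewrite ler_wpM2l//; lra.
  apply: (@le_trans _ _ ((1 - (s + t)) * ((1 + t) * h1))).
    by apply: ler_wpM2l; lra.
  apply: le_trans i2.
  have := mulr_ge0 (mulr_ge0 s0 t0) h10; have := mulr_ge0 (mulr_ge0 t0 t0) h10; lra.
move=> n; have [c1 c2] := claim n; move: (S1 n) (H0 0%N) (H0 n) c1 c2.
by move: (S n) (H 0%N) (H n) => s h h1; nra.
Qed.

End elliptic_transfer.

(** * One step of the perturbed recurrence *)

Section perturbed_transfer.
Context {R : realType}.
Context (a b g z : R[i]).
Context (g1 : normc g = 1) (z1 : normc z = 1) (a0 : a != 0).
Context (ab1 : normc a ^+ 2 + normc b ^+ 2 = 1).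
Implicit Types u v : R[i].

Local Notation zeta := (z * g^*).
Local Notation w := (b * g^*).
Local Notation h := (hform (Im zeta) w).

(** Up to the phase [g], the vector [a * (u0, v0)] is the matrix of [hform_transfer] applied to
    [(u, v)]. Its factor [|zeta|^2 - |w|^2 = 1 - |b|^2 = |a|^2] cancels against the scaling by
    [a]. *)
Lemma hform_step u v u0 v0 : a * u0 + b * v = z * u ->
  - b^* * g ^+ 2 * u0 + a^* * g ^+ 2 * v = z * v0 -> h u0 v0 = h u v.
Proof.
move=> e0 e1.
have gg : g * g^* = 1 by rewrite mulc_conj g1 expr1n.
have zz : z * z^* = 1 by rewrite mulc_conj z1 expr1n.
have aa : a * a^* = 1 - b * b^*.
  have one : (1 : R[i]) = (normc a ^+ 2 + normc b ^+ 2)%:C by rewrite ab1.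
  by rewrite !mulc_conj one rmorphD addrK.
have au : a * u0 = g * (zeta * u - w * v).
  rewrite (_ : g * _ = (g * g^*) * (z * u - b * v)); last by ring.
  by rewrite gg mul1r -e0 addrK.
have av : a * v0 = g * (zeta^* * v - w^* * u).
  rewrite !conjcM !conjcK.
  rewrite -[LHS]mul1r -zz (_ : _ * (a * v0) = z^* * (a * (z * v0))); last by ring.
  rewrite -e1 (_ : a * _ = - b^* * g ^+ 2 * (a * u0) +
    (a * a^*) * (g ^+ 2 * v)); last by ring.
  rewrite aa (_ : a * u0 = z * u - b * v); last by rewrite -e0 addrK.
  rewrite (_ : z^* * _ = z^* * g ^+ 2 * v - (z * z^*) * (g ^+ 2 * b^* * u)); last by ring.
  by rewrite zz; ring.
have na : normc a ^+ 2 != 0.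
  by rewrite sqrf_eq0; apply: contra a0 => /eqP/eq0_normc ->.
apply: (mulfI na); rewrite -hformZ au av hformZ g1 expr1n mul1r hform_transfer.
by rewrite !normcM normc_conj g1 !mulr1 z1 expr1n -ab1 addrK.
Qed.

Lemma normc_lin_le (x y x' y' : R[i]) (X Y X' Y' : R) :
  normc x <= X -> normc y <= Y -> normc x' <= X' -> normc y' <= Y' ->
  normc (x * y + x' * y') <= X * Y + X' * Y'.
Proof.
move=> hx hy hx' hy'; apply: le_trans (le_normcD _ _) _; rewrite !normcM.
by apply: lerD; apply: ler_pM; rewrite ?normc_ge0.
Qed.

(** The perturbed step is compared with the constant step [(u0, v0)] from the same [(u, v)], along
    which the form is exactly conserved. [kappa] gathers the losses from dividing by [a] and by
    [a']. *)
Lemma hform_perturbed_step (a' b' c' d' u v u' v' : R[i]) (delta e kappa : R) :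
  kappa = (1 + (normc a)^-1) * (1 + delta^-1) ->
  0 < delta -> delta <= normc a' -> normc c' <= 1 -> 0 <= e <= 1 ->
  normc (a' - a) <= e -> normc (b' - b) <= e ->
  normc (c' - - b^* * g ^+ 2) <= e -> normc (d' - a^* * g ^+ 2) <= e ->
  a' * u' + b' * v = z * u -> c' * u' + d' * v = z * v' ->
  `| `|h u' v'| - `|h u v| | <= 32 * kappa ^+ 2 * e * (normc u ^+ 2 + normc v ^+ 2).
Proof.
move=> kPD dl0 da c1 /andP[e0 e1] ea eb ec ed E0 E1.
set m := normc u + normc v.
have m0 : 0 <= m by rewrite addr_ge0 ?normc_ge0.
have p0 : 0 < normc a.
  by rewrite lt_def normc_ge0 andbT; apply: contra a0 => /eqP/eq0_normc ->.
have zn0 : z != 0.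
  by apply/eqP => ze; move: z1; rewrite ze normc0 => /esym/eqP; rewrite oner_eq0.
have p1 : normc a <= 1.
  by rewrite -(@ler_pXn2r _ 2)// ?nnegrE ?normc_ge0 ?ler01// expr1n -ab1 lerDl sqr_ge0.
have b1 : normc b <= 1.
  by rewrite -(@ler_pXn2r _ 2)// ?nnegrE ?normc_ge0 ?ler01// expr1n -ab1 lerDr sqr_ge0.
have um : normc u <= m by rewrite lerDl normc_ge0.
have vm : normc v <= m by rewrite lerDr normc_ge0.
pose u0 := (z * u - b * v) / a.
pose v0 := (- b^* * g ^+ 2 * u0 + a^* * g ^+ 2 * v) / z.
have F0 : a * u0 + b * v = z * u by rewrite /u0 mulrC divfK// subrK.
have F1 : - b^* * g ^+ 2 * u0 + a^* * g ^+ 2 * v = z * v0.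
  by rewrite /v0 [RHS]mulrC divfK.
have hE : h u0 v0 = h u v by exact: hform_step.
pose P := 1 + (normc a)^-1; pose D := 1 + delta^-1.
have P1 : 1 <= P by rewrite lerDl invr_ge0 normc_ge0.
have D1 : 1 <= D by rewrite lerDl invr_ge0 ltW.
rewrite -/P -/D in kPD.
have u0m : normc u0 <= (normc a)^-1 * m.
  rewrite /u0 normcM normcV mulrC ler_pM2l ?invr_gt0//.
  rewrite -mulNr; apply: le_trans (le_normcD _ _) _.
  by rewrite !normcM normcN z1 mul1r lerD2l ler_piMl ?normc_ge0.
have v0m : normc v0 <= P * m.
  have -> : normc v0 = normc (z * v0) by rewrite [RHS]normcM z1 mul1r.
  rewrite -F1; apply: le_trans (normc_lin_le (Y := (normc a)^-1 * m) (Y' := m)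
    (X := 1) (X' := 1) _ _ _ _) _ => //.
  - by rewrite normcM normcN normc_conj expr2 normcM g1 !mulr1.
  - by rewrite normcM normc_conj expr2 normcM g1 !mulr1.
  - by rewrite /P; lra.
have du : normc (u' - u0) <= delta^-1 * (e * (P * m)).
  rewrite ler_pdivlMl//; apply: (@le_trans _ _ (normc (a' * (u' - u0)))).
    by rewrite normcM ler_wpM2r ?normc_ge0.
  have -> : a' * (u' - u0) = (a - a') * u0 + (b - b') * v.
    rewrite !mulrBl mulrBr.
    have -> : a' * u' = z * u - b' * v by rewrite -E0 addrK.
    have -> : a * u0 = z * u - b * v by rewrite -F0 addrK.
    ring.
  apply: le_trans (normc_lin_le (X := e) (X' := e) _ u0m _ vm) _.
  - by rewrite normc_distC.
  - by rewrite normc_distC.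
  - by rewrite /P; lra.
have dv : normc (v' - v0) <= kappa * e * m.
  have -> : normc (v' - v0) = normc (z * (v' - v0)) by rewrite [RHS]normcM z1 mul1r.
  have -> : z * (v' - v0) = c' * (u' - u0) +
     ((c' - - b^* * g ^+ 2) * u0 + (d' - a^* * g ^+ 2) * v).
    by rewrite mulrBr -E1 -F1; ring.
  apply: le_trans (le_normcD _ _) _; rewrite normcM.
  apply: (@le_trans _ _ (delta^-1 * (e * (P * m)) + (e * ((normc a)^-1 * m) + e * m))).
    apply: lerD; last exact: normc_lin_le.
    by rewrite -[leRHS]mul1r; apply: ler_pM; rewrite ?normc_ge0.
  by rewrite kPD /D /P; lra.
have du' : normc (u' - u0) <= kappa * e * m.
  apply: le_trans du _; rewrite kPD /D.
  have := mulr_ge0 (mulr_ge0 e0 m0) (le_trans ler01 P1); lra.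
have PkP : P * m <= kappa * m by rewrite kPD ler_wpM2r// ler_peMr// (le_trans ler01).
have k0 : 0 <= kappa * m by apply: le_trans PkP; rewrite mulr_ge0// (le_trans ler01).
have kem : kappa * e * m <= kappa * m by rewrite mulrAC ler_piMr.
have u0A : normc u0 <= kappa * m.
  by apply: le_trans u0m (le_trans _ PkP); rewrite /P mulrDl mul1r lerDr.
have v0A : normc v0 <= kappa * m by exact: le_trans v0m PkP.
have y1 : `|Im zeta| <= 1.
  have zeta1 : normc zeta = 1 by rewrite normcM normc_conj g1 mulr1.
  apply: le_trans (_ : normc zeta <= 1); last by rewrite zeta1.
  by case: (zeta) => ? ? /=; rewrite -sqrtr_sqr ler_wsqrtr// lerDr sqr_ge0.
have w1 : normc w <= 1 by rewrite normcM normc_conj g1 mulr1.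
(* As [e <= 1], the radius [2 * (kappa * m)] holds both steps. The constant 32 is 8 from
   [hform_perturb], 2 from this radius and 2 from the bound on [m ^+ 2]. *)
have := @hform_perturb _ (Im zeta) w u0 v0 u' v' (2 * (kappa * m)) (kappa * e * m) y1 w1.
have tA x x0 : normc x0 <= kappa * m -> normc (x - x0) <= kappa * e * m ->
    normc x <= 2 * (kappa * m).
  move=> hx hd; rewrite -[x](subrK x0); apply: le_trans (le_normcD _ _) _; lra.
have t0 x : normc x <= kappa * m -> normc x <= 2 * (kappa * m) by lra.
move=> /(_ (t0 _ u0A) (t0 _ v0A) (tA _ _ u0A du') (tA _ _ v0A dv) du' dv).
rewrite hE => hd; apply: le_trans (ler_dist_dist _ _) _.
apply: le_trans hd _.
have -> : 8 * (2 * (kappa * m)) * (kappa * e * m) = 16 * kappa ^+ 2 * e * m ^+ 2 by ring.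
have mE : m ^+ 2 <= 2 * (normc u ^+ 2 + normc v ^+ 2).
  by have := sqr_ge0 (normc u - normc v); rewrite /m; move: (normc u) (normc v) => *; lra.
have ke0 : 0 <= 16 * kappa ^+ 2 * e by rewrite mulr_ge0// mulr_ge0// sqr_ge0.
have := ler_wpM2l ke0 mE; lra.
Qed.

End perturbed_transfer.

(** * Bounded solutions on a half-line and Weyl sequences *)

Section elliptic_solutions.
Context {R : realType} (C : int -> 'M[R[i]]_2).
Context (unitC : forall x, C x \is unitarymx).
Context (a b g z : R[i]) (delta M r : R).
Context (g1 : normc g = 1) (z1 : normc z = 1) (a0 : a != 0).
Context (ab1 : normc a ^+ 2 + normc b ^+ 2 = 1).
Context (delta0 : 0 < delta) (Cdelta : forall x, delta <= normc (C x 0 0)).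
Context (M0 : 0 <= M) (r01 : 0 <= r < 1).
Context (decay : forall n : nat, [/\ normc (C n 0 0 - a) <= M * r ^+ n,
  normc (C n 0 1 - b) <= M * r ^+ n,
  normc (C n 1 0 - - b^* * g ^+ 2) <= M * r ^+ n &
  normc (C n 1 1 - a^* * g ^+ 2) <= M * r ^+ n]).
Context (elliptic : normc b < `|Im (z * g^*)|).
Local Notation U := (walk unitC).

Let zn0 : z != 0.
Proof.
by apply/eqP => ze; move: z1; rewrite ze normc0 => /esym/eqP; rewrite oner_eq0.
Qed.

Let C00 x : C x 0 0 != 0.
Proof.
by apply/eqP => c0; have := Cdelta x; rewrite c0 normc0 leNgt delta0.
Qed.

Lemma unitary_entry_le1 (A : 'M[R[i]]_2) : A \is unitarymx -> normc (A 1 0) <= 1.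
Proof.
move=> uA; pose e : 'cV[R[i]]_2 := \col_i (i == 0)%:R.
rewrite -(@ler_pXn2r _ 2)// ?nnegrE ?normc_ge0 ?ler01// expr1n.
have := sqn_unitary e uA; rewrite !sqnE !mul2E !mxE /= !mulr0 !mulr1 !addr0.
rewrite !expr0n !expr1n /= !addr0 sqrtr0 sqrtr1 expr0n expr1n /= addr0 => <-.
by rewrite lerDr sqr_ge0.
Qed.

(** [u n] is component 0 at the site [X + n - 1] and [v n] is component 1 at [X + n]. So
    [(u n, v n)] is the state that the recurrence advances, while [u n.+1] and [v n] share a
    site. *)
Definition half_line_solution (X : nat) (u v : nat -> R[i]) := forall n,
  C (X + n)%N 0 0 * u n.+1 + C (X + n)%N 0 1 * v n = z * u n /\
  C (X + n)%N 1 0 * u n.+1 + C (X + n)%N 1 1 * v n = z * v n.+1.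

Lemma elliptic_bounds : exists (X : nat) (c B : R), [/\ 0 < c, 0 < B &
  forall u v, half_line_solution X u v -> forall n,
    c * (normc (u 0%N) ^+ 2 + normc (v 0%N) ^+ 2) <= normc (u n) ^+ 2 + normc (v n) ^+ 2 /\
    normc (u n) ^+ 2 + normc (v n) ^+ 2 <= B * (normc (u 0%N) ^+ 2 + normc (v 0%N) ^+ 2)].
Proof.
have bg : normc (b * g^*) = normc b by rewrite normcM normc_conj g1 mulr1.
pose eta := `|Im (z * g^*)| - normc b.
have eta0 : 0 < eta by rewrite subr_gt0.
pose kappa := (1 + (normc a)^-1) * (1 + delta^-1).
pose L := 32 * kappa ^+ 2 * M / eta.
have L0 : 0 <= L.
  apply: divr_ge0; last exact: ltW.
  by apply: mulr_ge0 => //; apply: mulr_ge0 => //; exact: sqr_ge0.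
have /andP[r0 r1] := r01; have r1' : 0 < 1 - r by rewrite subr_gt0.
(* Two demands on [X] in one: coin errors at most 1 beyond [X], and relative variations of the form
   with sum at most 1/2. *)
have [X XP] := @expr_small _ r (M + 2 * (L / (1 - r))) 1 r01 ltr01.
have rX0 : 0 <= r ^+ X by rewrite exprn_ge0.
have {XP} : r ^+ X * M + 2 * (r ^+ X * (L / (1 - r))) < 1.
  by have := XP X (leqnn X); rewrite mulrDr mulrCA.
have rM0 : 0 <= r ^+ X * M by rewrite mulr_ge0.
have rL0 : 0 <= r ^+ X * (L / (1 - r)) by rewrite mulr_ge0// divr_ge0// ltW.
move=> Xlt1.
(* From [eta * E n <= H n <= 2 * E n] and the factor 2 within which [H] varies. *)
exists X, (eta / 4), (4 / eta); split; rewrite ?divr_gt0//.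
move=> u v sol; pose H n := `|hform (Im (z * g^*)) (b * g^*) (u n) (v n)|.
pose E n := normc (u n) ^+ 2 + normc (v n) ^+ 2.
have EH n : eta * E n <= H n.
  by have := hform_ge (Im (z * g^*)) (b * g^*) (u n) (v n); rewrite bg.
have y1 : `|Im (z * g^*)| <= 1.
  have zeta1 : normc (z * g^*) = 1 by rewrite normcM normc_conj g1 mulr1.
  apply: le_trans (_ : normc (z * g^*) <= 1); last by rewrite zeta1.
  by case: (z * g^*) => ? ? /=; rewrite -sqrtr_sqr ler_wsqrtr// lerDr sqr_ge0.
have E0 n : 0 <= E n by rewrite addr_ge0 ?sqr_ge0.
have HE n : H n <= 2 * E n.
  apply: le_trans (hform_le _ _ _ _) _; rewrite bg -/(E n); apply: ler_wpM2r => //.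
  by have := elliptic; lra.
have HS n : `|H n.+1 - H n| <= (L * r ^+ X) * r ^+ n * H n.
  have [s0 s1] := sol n; have [ea eb ec ed] := decay (X + n).
  have e01 : 0 <= M * r ^+ (X + n) <= 1.
    rewrite mulr_ge0 ?exprn_ge0//= exprD mulrA (mulrC M).
    apply: (@le_trans _ _ (r ^+ X * M)); last by lra.
    by rewrite ler_piMr// exprn_ile1// ltW.
  apply: le_trans (hform_perturbed_step g1 z1 a0 ab1 (erefl kappa) delta0
    (Cdelta _) (unitary_entry_le1 (unitC _)) e01 ea eb ec ed s0 s1) _.
  rewrite -/(E n) (_ : _ * E n = L * r ^+ X * r ^+ n * (eta * E n)).
    apply: ler_wpM2l; last exact: EH.
    by apply: mulr_ge0; [exact: mulr_ge0|exact: exprn_ge0].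
  by rewrite exprD /L; field; rewrite gt_eqF.
have e0 : 0 <= L * r ^+ X by rewrite mulr_ge0.
have e1 : L * r ^+ X / (1 - r) <= 1 / 2.
  by rewrite mulrAC mulrC; move: (r ^+ X * (L / (1 - r))) rL0 rM0 Xlt1 => *; lra.
have Hn n : 0 <= H n by exact: normr_ge0.
move=> n; have [h1 h2] := slowly_varying_bounds e0 r01 e1 Hn HS n.
rewrite -/(E 0%N) -/(E n); move: (EH 0%N) (EH n) (HE 0%N) (HE n) h1 h2.
move: (H 0%N) (H n) (E 0%N) (E n) => h0 hn e00 en i1 i2 i3 i4 i5 i6; split; first by lra.
rewrite mulrAC ler_pdivlMr// mulrC; lra.
Qed.

Lemma elliptic_no_eigenvalue : ~ is_eigenvalue U z.
Proof.
move=> [psi psi0 Up]; have [X [c [B [c0 B0 XP]]]] := elliptic_bounds.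
pose u n := psi (X%:Z + n%:Z - 1) 0 0; pose v n := psi (X%:Z + n%:Z) 1 0.
have sol : half_line_solution X u v.
  move=> n; rewrite /u /v PoszD.
  have -> : X%:Z + n.+1%:Z = X%:Z + n%:Z + 1 by rewrite intS; ring.
  rewrite addrK; split; first exact: (eigen_eq0 _ Up).
  exact: (eigen_eq1 _ Up).
have {}XP := XP u v sol.
pose E0 := normc (u 0%N) ^+ 2 + normc (v 0%N) ^+ 2.
have E00 : 0 <= E0 by rewrite addr_ge0 ?sqr_ge0.
(* The factor 2 appears because a state straddles two neighbouring sites. A nonzero [E0] would force
   infinite mass. *)
have NE (N : nat) : N%:R * (c * E0) <= 2 * l2norm psi ^+ 2.
  have sites (k : int) : \sum_(n < N) sqn (psi (k + n%:Z)) <= l2norm psi ^+ 2.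
    rewrite -(big_mkord xpredT (fun n => sqn (psi (k + n%:Z)))) /index_iota subn0.
    rewrite -(big_map (fun n : nat => k + n%:Z) xpredT (fun x => sqn (psi x))).
    by apply: sum_sqn_le; rewrite map_inj_uniq ?iota_uniq// => i j /addrI [].
  have ge1 : N%:R * (c * E0) <=
      \sum_(n < N) (sqn (psi (X%:Z - 1 + n%:Z)) + sqn (psi (X%:Z + n%:Z))).
    rewrite mulr_natl -[X in _ *+ X]card_ord -sumr_const; apply: ler_sum => n _.
    apply: le_trans (XP n).1 _; rewrite /u /v [X%:Z - 1 + _]addrAC !sqnE.
    by apply: lerD; rewrite ?lerDl ?lerDr sqr_ge0.
  apply: le_trans ge1 _; rewrite big_split/= mulr_natl mulr2n.
  by apply: lerD; exact: sites.
have : E0 = 0.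
  apply/eqP; rewrite eq_le E00 andbT leNgt; apply/negP => Epos.
  have cE : 0 < c * E0 by rewrite mulr_gt0.
  have := NE (Num.truncn (2 * l2norm psi ^+ 2 / (c * E0))).+1.
  rewrite -ler_pdivlMr// leNgt; apply/negP/negPn.
  by rewrite truncnS_gt.
move/eqP; rewrite paddr_eq0 ?sqr_ge0// !sqrf_eq0.
move=> /andP[/eqP/eq0_normc u0 /eqP/eq0_normc v0].
move/eqP: psi0; apply; apply: (@eigen_state0 _ _ unitC C00 z psi X%:Z zn0 Up).
  by move: u0; rewrite /u addr0.
by move: v0; rewrite /v addr0.
Qed.

(* Weyl sequence: solutions on a half-line truncated to N sites have mass of
   order N while the truncation only creates errors at four sites. *)
Lemma truncated_solution (X N : nat) (u v : nat -> R[i]) (B : R) :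
  half_line_solution X u v -> 0 <= B ->
  (forall n, normc (u n.+1) ^+ 2 + normc (v n) ^+ 2 <= 2 * B) ->
  exists psi : l2 R, l2norm (U psi - z *: psi) ^+ 2 <= 48 * B /\
    \sum_(n < N) (normc (u n.+1) ^+ 2 + normc (v n) ^+ 2) <= l2norm psi ^+ 2.
Proof.
clear -unitC z1 => sol B0 uvB.
pose f (x : int) : 'cV[R[i]]_2 := if (X%:Z <= x) && (x < X%:Z + N%:Z) then
  \col_j (if j == 0 then u (absz (x - X%:Z)%R).+1 else v (absz (x - X%:Z)%R)) else 0.
have f_in (n : nat) : (n < N)%N ->
    f (X%:Z + n%:Z) 0 0 = u n.+1 /\ f (X%:Z + n%:Z) 1 0 = v n.
  move=> nN; rewrite /f (_ : _ && _ = true); last by lia.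
  have -> : absz (X%:Z + n%:Z - X%:Z)%R = n by lia.
  by rewrite !mxE.
have f_out x : x < X%:Z \/ X%:Z + N%:Z <= x -> f x = 0.
  by move=> xo; rewrite /f (_ : _ && _ = false)//; lia.
pose sites : seq int := [seq X%:Z + n%:Z | n <- iota 0 N].
have usites : uniq sites by rewrite map_inj_uniq ?iota_uniq// => i j /addrI [].
have f_sites x : x \notin sites -> f x = 0.
  move=> xs; apply: f_out; have [xX|xX] := ltP x X%:Z; first by left.
  right; rewrite leNgt; apply/negP => xN; move/negP: xs; apply.
  apply/mapP; exists (absz (x - X%:Z)%R); last by lia.
  by rewrite mem_iota; lia.
have f_l2 : f \in square_summable.
  apply: (@square_summable_bounded _ _ (\sum_(x <- sites) sqn (f x))) => s us.
  exact: sum_sqn_le_supp.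
pose psi := L2 f_l2.
have sqn_f x : sqn (f x) <= 2 * B.
  have [xs|/f_sites ->] := boolP (x \in sites); last first.
    by rewrite sqnE !mxE normc0 expr0n addr0 mulr_ge0.
  have /mapP[n] := xs; rewrite mem_iota => /andP[_ nN] ->.
  have [f0 f1] := f_in n nN; rewrite sqnE f0 f1; exact: uvB.
have mass : \sum_(n < N) (normc (u n.+1) ^+ 2 + normc (v n) ^+ 2) <= l2norm psi ^+ 2.
  apply: le_trans (sum_sqn_le psi usites); rewrite big_map.
  rewrite -(big_mkord xpredT (fun n => normc (u n.+1) ^+ 2 + normc (v n) ^+ 2)).
  rewrite /index_iota subn0 big_seq [leRHS]big_seq; apply: ler_sum => n.
  rewrite mem_iota => /andP[_ nN].
  by have [f0 f1] := f_in n nN; rewrite sqnE f0 f1.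
pose bad : seq int := undup [:: X%:Z - 1; X%:Z; X%:Z + N%:Z - 1; X%:Z + N%:Z].
have resid_out x : x \notin bad -> (U psi - z *: psi) x = 0.
  rewrite mem_undup !inE !negb_or => /and4P[x1 x2 x3 x4].
  apply/colP => j; rewrite l2_subE l2_scaleE [RHS]mxE.
  case: (unliftP 0 j) => [k ->|->].
    have -> : lift 0 k = 1 :> 'I_2 by apply: val_inj; case: k => -[].
    rewrite walk1E; have [xX|xX] := ltP x X%:Z.
      by rewrite /= (f_out (x - 1)) ?(f_out x) ?mxE; [ring|left; lia..].
    have [xN|xN] := ltP x (X%:Z + N%:Z); last first.
      by rewrite /= (f_out (x - 1)) ?(f_out x) ?mxE; [ring|right; lia..].
    pose n := absz (x - 1 - X%:Z)%R.
    have nx : x - 1 = X%:Z + n%:Z by lia.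
    have nx' : x = X%:Z + n.+1%:Z by lia.
    have [f0 f1] := f_in n ltac:(lia); have [_ f1'] := f_in n.+1 ltac:(lia).
    rewrite nx [in X in _ - X]nx' /= f0 f1 f1'.
    by have [_ s1] := sol n; rewrite -PoszD s1 subrr.
  rewrite walk0E; have [xX|xX] := ltP x X%:Z.
    by rewrite /= (f_out (x + 1)) ?(f_out x) ?mxE; [ring|left; lia..].
  have [xN|xN] := ltP x (X%:Z + N%:Z); last first.
    by rewrite /= (f_out (x + 1)) ?(f_out x) ?mxE; [ring|right; lia..].
  pose n := (absz (x - X%:Z)%R).
  have nx : x + 1 = X%:Z + n.+1%:Z by lia.
  have nx' : x = X%:Z + n%:Z by lia.
  have [f0 f1] := f_in n.+1 ltac:(lia); have [f0' _] := f_in n ltac:(lia).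
  rewrite nx [in X in _ - X]nx' /= f0 f1 f0'.
  by have [s0 _] := sol n.+1; rewrite -PoszD s0 subrr.
have resid : l2norm (U psi - z *: psi) ^+ 2 <= 48 * B.
  apply: le_trans (l2norm_sqr_le_supp (undup_uniq _) resid_out) _.
  (* A bad site costs at most [2 * (2 * B + 2 * B)] from [U psi] and [2 * (2 * B)] from [z *: psi];
     there are at most four. *)
  apply: le_trans (sum_seq_le (e := 12 * B) _) _.
    move=> x _; apply: le_trans (sqn_add2 _ _) _; rewrite sqnN.
    have := sqn_walk_le unitC psi x.
    have -> : sqn ((z *: psi : l2 R) x) = sqn (f x) by rewrite sqnZ z1 expr1n mul1r.
    have := sqn_f x; have := sqn_f (x + 1); have := sqn_f (x - 1); rewrite /=; lra.
  have sz : (size bad)%:R <= 4 :> R by rewrite ler_nat; exact: size_undup.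
  by have := ler_wpM2r B0 sz; lra.
by exists psi.
Qed.

Lemma elliptic_not_bounded_below (c0 : R) : 0 < c0 ->
  exists psi : l2 R, l2norm (U psi - z *: psi) < c0 * l2norm psi.
Proof.
move=> c0_gt0; have [X [c [B [cpos B0 XP]]]] := elliptic_bounds.
pose step (n : nat) (p : R[i] * R[i]) :=
  let u' := (z * p.1 - C (X + n)%N 0 1 * p.2) / C (X + n)%N 0 0 in
  (u', (C (X + n)%N 1 0 * u' + C (X + n)%N 1 1 * p.2) / z).
pose st := fix st n := if n is m.+1 then step m (st m) else (1, 0) : R[i] * R[i].
pose u n := (st n).1; pose v n := (st n).2.
have sol : half_line_solution X u v.
  move=> n; rewrite /u /v /= -/(u n) -/(v n); split.
    by rewrite [C _ 0 0 * _]mulrC divfK// subrK.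
  by rewrite [RHS]mulrC divfK.
have E0 : normc (u 0%N) ^+ 2 + normc (v 0%N) ^+ 2 = 1.
  by rewrite /u /v normc0 normc1 expr1n expr0n addr0.
have {XP} XP n : c <= normc (u n) ^+ 2 + normc (v n) ^+ 2 <= B.
  by have [] := XP u v sol n; rewrite E0 !mulr1 => -> ->.
pose F n := normc (u n.+1) ^+ 2 + normc (v n) ^+ 2.
have F_le n : F n <= 2 * B.
  have /andP[_ h1] := XP n.+1; have /andP[_ h2] := XP n; rewrite /F.
  have := sqr_ge0 (normc (u n)); have := sqr_ge0 (normc (v n.+1)); lra.
(* [F n] is the mass at one site, whereas [XP] bounds states. The next state consists of [u n.+1]
   and of [v n.+1], which the unitary coin produces from this site. *)
have F_ge n : c / 3 <= F n.
  have [_ s1] := sol n.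
  have v2 : normc (v n.+1) ^+ 2 <= 2 * F n.
    pose q : 'cV[R[i]]_2 := \col_j (if j == 0 then u n.+1 else v n).
    have qF : sqn q = F n by rewrite sqnE !mxE.
    have -> : normc (v n.+1) = normc ((C (X + n)%N *m q) 1 0).
      by rewrite mul2E !mxE /= s1 [RHS]normcM z1 mul1r.
    rewrite -qF -(sqn_unitary q (unitC (X + n)%N)) sqnE.
    have := sqr_ge0 (normc ((C (X + n)%N *m q) 0 0)).
    by have := sqr_ge0 (normc ((C (X + n)%N *m q) 1 0)); lra.
  have /andP[h1 _] := XP n.+1.
  have := sqr_ge0 (normc (v n)); move: v2; rewrite /F; lra.
(* Chosen so that [c0 ^+ 2] times the mass [N * (c / 3)] exceeds the residual bound [48 * B]. *)
pose N := (Num.truncn (144 * B / (c0 ^+ 2 * c))).+1.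
have [psi [resid mass]] := truncated_solution N sol (ltW B0) F_le; exists psi.
have {}mass : N%:R * (c / 3) <= l2norm psi ^+ 2.
  apply: le_trans mass; rewrite mulr_natl -[X in _ *+ X]card_ord -sumr_const.
  by apply: ler_sum => n _; exact: F_ge.
rewrite -(@ltr_pXn2r _ 2)// ?nnegrE ?mulr_ge0 ?l2norm_ge0// ?ltW//.
apply: le_lt_trans resid _; rewrite exprMn.
apply: (@lt_le_trans _ _ (c0 ^+ 2 * (N%:R * (c / 3)))); last first.
  by rewrite ler_pM2l// exprn_gt0.
have cc : 0 < c0 ^+ 2 * c by rewrite mulr_gt0// exprn_gt0.
have := truncnS_gt (144 * B / (c0 ^+ 2 * c)); rewrite -/N ltr_pdivrMr//.
by move: (N%:R) => K; lra.
Qed.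

End elliptic_solutions.

(** * The arcs and the spectrum *)

Section arcs.
Context {R : realType}.
Implicit Types (z zeta w : R[i]) (p gamma t : R).

Lemma normc_expi t : normc (expi t) = 1.
Proof. by rewrite /= cos2Dsin2 sqrtr1. Qed.

Lemma expiD t1 t2 : expi (t1 + t2) = expi t1 * expi t2 :> R[i].
Proof.
by rewrite /expi cosD sinD [RHS]/GRing.mul/=; congr Complex; rewrite addrC mulrC.
Qed.

Lemma expiN t : expi (- t) = (expi t)^* :> R[i].
Proof. by rewrite /expi cosN sinN. Qed.

Lemma expi_conjK z t : z * (expi t)^* * expi t = z.
Proof. by rewrite -mulrA (mulrC _^*) mulc_conj normc_expi expr1n mulr1. Qed.

Lemma cos_2piB t : cos (2 * pi - t) = cos t :> R.
Proof. by rewrite mulr_natl cosB cos2pi sin2pi mul1r mul0r addr0. Qed.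

Lemma sin_2piB t : sin (2 * pi - t) = - sin t :> R.
Proof. by rewrite mulr_natl sinB cos2pi sin2pi mul1r mul0r sub0r. Qed.

Lemma Re_unit_itv zeta : normc zeta = 1 -> -1 <= Re zeta <= 1.
Proof. by move=> z1; rewrite -ler_norml -z1 normc_Re. Qed.

Lemma unit_arg zeta : normc zeta = 1 ->
  zeta = expi (acos (Re zeta)) \/ zeta = expi (2 * pi - acos (Re zeta)).
Proof.
move=> z1; have itv := Re_unit_itv z1.
have co : cos (acos (Re zeta)) = Re zeta by rewrite acosK// in_itv.
have := sin_acos itv; have : Im zeta ^+ 2 = 1 - Re zeta ^+ 2.
  by rewrite -(expr1n _ 2) -[1 in RHS]z1 sqr_normcE; ring.
move=> <-; rewrite sqrtr_sqr /expi cos_2piB sin_2piB co => ->.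
case: zeta {z1 itv co} => x y /=; have [y0|y0] := leP 0 y.
  by left; rewrite ger0_norm.
by right; rewrite ltr0_norm// opprK.
Qed.

Lemma acos_le p x : 0 < p <= 1 -> `|x| <= p -> acos p <= acos x <= pi - acos p.
Proof.
move=> /andP[p0 p1]; rewrite ler_norml => /andP[px xp].
have pitv : -1 <= p <= 1 by apply/andP; split; lra.
have xitv : -1 <= x <= 1 by apply/andP; split; lra.
have mono (s t : R) : -1 <= s <= 1 -> -1 <= t <= 1 -> s <= t -> acos t <= acos s.
  move=> si ti st; rewrite leNgt; apply/negP => lt1; move: st; apply/negP.
  rewrite -ltNge -(acosK (x := s)) ?in_itv// -(acosK (x := t)) ?in_itv//.
  by rewrite ltr_cos ?in_itv/= ?acos_ge0 ?acos_lepi.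
have Npitv : -1 <= - p <= 1 by apply/andP; split; lra.
by rewrite -acosN// !mono.
Qed.

(** After rotation by [- gamma / 2] the second arc is the image of the first under
    [t |-> 2 * pi - t], which preserves the cosine; so the real part alone describes both. *)
Lemma arcP p gamma z : 0 < p <= 1 ->
  [set expi theta | theta in J p gamma] z <->
  normc z = 1 /\ `|Re (z * (expi (gamma / 2))^*)| <= p.
Proof.
move=> p01; have /andP[p0 p1] := p01.
have pitv : -1 <= p <= 1 by apply/andP; split; lra.
have ap0 := acos_ge0 pitv; have appi := acos_lepi pitv.
have cp : cos (acos p) = p by rewrite acosK// in_itv.
have cosb t : acos p <= t <= pi - acos p -> `|cos t| <= p.
  move=> /andP[t1 t2].
  have t_itv : t \in `[0, pi] by rewrite in_itv/=; apply/andP; split; lra.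
  have cNp : cos (pi - acos p) = - p by rewrite -acosN// acosK// in_itv/=; lra.
  rewrite ler_norml -{1}cNp -{2}cp; apply/andP; split; rewrite leNgt.
    by rewrite ltr_cos ?in_itv/= ?t_itv// -?leNgt//; apply/andP; split; lra.
  by rewrite ltr_cos ?in_itv/= ?t_itv// -?leNgt//; apply/andP; split; lra.
split=> [[t Jt <-]|[z1 zp]].
  split; first exact: normc_expi.
  rewrite -expiN -expiD /=; case: Jt; rewrite /J1 /J2 /= in_itv/= => /andP[t1 t2].
    by apply: cosb; apply/andP; split; lra.
  by rewrite -cos_2piB; apply: cosb; apply/andP; split; lra.
set zeta := z * _ in zp; have zE : z = zeta * expi (gamma / 2) by rewrite expi_conjK.
have zeta1 : normc zeta = 1 by rewrite normcM normc_conj normc_expi mulr1.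
have /andP[a1 a2] := acos_le p01 zp.
have [e|e] := unit_arg zeta1; rewrite zE e -expiD.
  exists (acos (Re zeta) + gamma / 2) => //; left.
  by rewrite /J1 /= in_itv/=; apply/andP; split; lra.
exists (2 * pi - acos (Re zeta) + gamma / 2) => //; right.
by rewrite /J2 /= in_itv/=; apply/andP; split; lra.
Qed.

Lemma threshold_arcP p gamma z : 0 < p <= 1 -> normc z = 1 ->
  `|Re (z * (expi (gamma / 2))^*)| = p ->
  exists2 theta, JT p gamma theta & z = expi theta.
Proof.
move=> /andP[p0 p1] z1; set zeta := z * _ => zp.
have zE : z = zeta * expi (gamma / 2) by rewrite expi_conjK.
have zeta1 : normc zeta = 1 by rewrite normcM normc_conj normc_expi mulr1.
have pitv : -1 <= p <= 1 by apply/andP; split; lra.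
have ac : acos (Re zeta) = acos p \/ acos (Re zeta) = pi - acos p.
  have [x0|x0] := leP 0 (Re zeta); first by left; rewrite -zp ger0_norm.
  by right; rewrite -acosN// -zp ltr0_norm// opprK.
have [e|e] := unit_arg zeta1; case: ac => ac.
- exists (acos p + gamma / 2); last by rewrite zE e ac -expiD.
  by rewrite /JT; left; left; left.
- exists (pi - acos p + gamma / 2); last by rewrite zE e ac -expiD.
  by rewrite /JT; left; left; right.
- exists (2 * pi - acos p + gamma / 2); last by rewrite zE e ac -expiD.
  by rewrite /JT; right.
- exists (pi + acos p + gamma / 2); last first.
    by rewrite zE e ac -expiD; congr expi; lra.
  by rewrite /JT; left; right.
Qed.

Lemma sqrt_dist (x y : R) : 0 <= x -> 0 <= y ->
  (Num.sqrt x - Num.sqrt y) ^+ 2 <= `|x - y|.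
Proof.
move=> x0 y0; have -> : x - y = (Num.sqrt x - Num.sqrt y) * (Num.sqrt x + Num.sqrt y).
  by rewrite -subr_sqr !sqr_sqrtr.
rewrite -real_normK ?num_real// expr2 normrM ler_wpM2l//.
rewrite [leRHS]ger0_norm ?addr_ge0 ?sqrtr_ge0//.
rewrite ler_norml; have := sqrtr_ge0 x; have := sqrtr_ge0 y.
by move: (Num.sqrt x) (Num.sqrt y) => *; apply/andP; split; lra.
Qed.

(** It serves twice: to reach the ends of the arcs from the interior, and to show that no arc point
    is isolated. *)
Lemma unit_dense p zeta (e : R) : 0 < p <= 1 -> normc zeta = 1 ->
  `|Re zeta| <= p -> 0 < e ->
  exists w, [/\ normc w = 1, `|Re w| < p, w != zeta & normc (w - zeta) < e].
Proof.
case: zeta => x y /andP[p0 p1] xy1 /= xp e0.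
have y2 : y ^+ 2 = 1 - x ^+ 2.
  by have := sqr_normcE (x +i* y); rewrite xy1 expr1n /= => ->; ring.
(* A shift of the real part by [d <= p / 2] in the direction opposite to its sign stays strictly
   inside. The imaginary part moves by at most the root of [2 * d], and
   [d ^+ 2 + 2 * d < e ^+ 2]. *)
pose d := Num.min (p / 2) (e ^+ 2 / 4).
have d0 : 0 < d by rewrite lt_min !divr_gt0// exprn_gt0.
have dp : d <= p / 2 by rewrite ge_min lexx.
have de : d <= e ^+ 2 / 4 by rewrite ge_min lexx orbT.
pose x' := if 0 < x then x - d else x + d.
have x'x : x' != x.
  by rewrite /x'; case: ifP => _; rewrite -subr_eq0 addrC addKr ?oppr_eq0 gt_eqF.
have x'p : `|x'| < p.
  move: xp; rewrite ler_norml ltr_norml /x' => /andP[l1 l2].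
  by have [x0|x0] := ltP 0 x; apply/andP; split; lra.
have xd : (x' - x) ^+ 2 = d ^+ 2.
  by rewrite /x'; case: ifP => _; ring.
have x1 : `|x| <= 1 by exact: le_trans xp p1.
have x'1 : `|x'| <= 1 by exact: le_trans (ltW x'p) p1.
have sq1 t : `|t| <= 1 -> 0 <= 1 - t ^+ 2.
  by move=> t1; rewrite subr_ge0 -real_normK ?num_real// expr_le1.
pose s := Num.sqrt (1 - x' ^+ 2).
have s2 : s ^+ 2 = 1 - x' ^+ 2 by rewrite sqr_sqrtr ?sq1.
have sdist : (s - `|y|) ^+ 2 <= 2 * d.
  rewrite -(sqrtr_sqr y) y2; apply: le_trans (sqrt_dist (sq1 _ x'1) (sq1 _ x1)) _.
  rewrite (_ : _ - _ = (x - x') * (x + x')); last by ring.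
  rewrite normrM mulrC; apply: ler_pM => //.
    by apply: le_trans (ler_normD _ _) _; lra.
  rewrite /x'; case: ifP => _; first by rewrite subKr gtr0_norm.
  by rewrite opprD addNKr normrN gtr0_norm.
pose y' := if 0 <= y then s else - s.
have y'd : (y' - y) ^+ 2 <= 2 * d.
  rewrite /y'; move: sdist; have [y0|y0] := leP 0 y; first by rewrite ger0_norm.
  by rewrite ltr0_norm// -[leLHS]sqrrN; congr (_ ^+ 2 <= _); ring.
have y's : y' ^+ 2 = s ^+ 2 by rewrite /y'; case: ifP => _; rewrite ?sqrrN.
exists (x' +i* y'); split=> //.
- by rewrite /= y's s2 addrC subrK sqrtr1.
- by apply: contra x'x; rewrite eq_complex => /andP[].
rewrite -(@ltr_pXn2r _ 2)// ?nnegrE ?normc_ge0 ?ltW// sqr_normcE /= xd.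
have := exprn_gt0 2 e0; nra.
Qed.

End arcs.

(** * Determinant and unitarity of the constant coin *)

Section model_coin.
Context {R : realType}.

Lemma normc_entry_le (A : 'M[R[i]]_2) (e : R) j k :
  `|A| <= e%:C -> normc (A j k) <= e.
Proof.
move=> Ae; rewrite -lecR; apply: le_trans Ae; rewrite -[leLHS]/(`|A j k|).
rewrite [leRHS]/Num.Def.normr /= mx_normE.
rewrite -[leLHS]/((NngNum (normr_ge0 (A j k)))%:num) num_le.
by apply/bigmax_geP; right; exists (j, k); rewrite // -num_le.
Qed.

Context (p q alpha beta gamma : R) (hpq : p ^+ 2 + q ^+ 2 = 1).
Context (p0 : 0 < p) (q0 : 0 <= q).
Local Notation a := (p%:C * expi alpha).
Local Notation b := (q%:C * expi beta).
Local Notation g := (expi (gamma / 2)).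
Local Notation K := (C0 p q alpha beta gamma).

Lemma normc_C0_00 : normc a = p.
Proof. by rewrite normcM normc_expi mulr1 normc_real gtr0_norm. Qed.

Lemma normc_C0_01 : normc b = q.
Proof. by rewrite normcM normc_expi mulr1 normc_real ger0_norm. Qed.

Lemma expi_half_sqr : g ^+ 2 = expi gamma.
Proof. by rewrite expr2 -expiD; congr expi; lra. Qed.

Lemma conj_realM (t : R) (x : R[i]) : (t%:C * x)^* = t%:C * x^*.
Proof. by case: x => x y; rewrite /GRing.mul/=; congr Complex; ring. Qed.

Lemma C0_00 : K 0 0 = a. Proof. by rewrite mxE. Qed.

Lemma C0_01 : K 0 1 = b. Proof. by rewrite mxE. Qed.

Lemma C0_10 : K 1 0 = - b^* * g ^+ 2.
Proof.
rewrite mxE [LHS]/= conj_realM -expiN expi_half_sqr -!mulNr -mulrA -expiD.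
by congr (_ * expi _); ring.
Qed.

Lemma C0_11 : K 1 1 = a^* * g ^+ 2.
Proof.
rewrite mxE [LHS]/= conj_realM -expiN expi_half_sqr -mulrA -expiD.
by congr (_ * expi _); ring.
Qed.

Lemma det_C0 : K 0 0 * K 1 1 - K 0 1 * K 1 0 = g ^+ 2.
Proof.
rewrite C0_00 C0_01 C0_10 C0_11.
rewrite (_ : _ - _ = (a * a^* + b * b^*) * g ^+ 2); last by ring.
by rewrite !mulc_conj normc_C0_00 normc_C0_01 -rmorphD/= hpq mul1r.
Qed.

Lemma C0_unitary : K \is unitarymx.
Proof.
have gg : g ^+ 2 * (g ^+ 2)^* = 1.
  by rewrite expi_half_sqr mulc_conj normc_expi expr1n.
have aabb : a * a^* + b * b^* = 1.
  by rewrite !mulc_conj normc_C0_00 normc_C0_01 -rmorphD/= hpq.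
apply/unitarymxP/matrixP => j k.
have E i l : (K *m K^t*) i l = K i 0 * (K l 0)^* + K i 1 * (K l 1)^*.
  rewrite mxE !big_ord_recl big_ord0 addr0 !mxE.
  have -> : lift ord0 (ord0 : 'I_1) = 1 :> 'I_2 by apply: val_inj.
  by [].
have ord2 (i : 'I_2) : i = 0 \/ i = 1.
  by case: (unliftP 0 i) => [[[|//] ?]|] ->; [right|left]; apply: val_inj.
rewrite E; case: (ord2 j) => ->; case: (ord2 k) => ->.
- by rewrite C0_00 C0_01 aabb mxE.
- rewrite C0_00 C0_01 C0_10 C0_11 !(conjcM, conjcN, conjcK) [RHS]mxE [RHS]/=; ring.
- rewrite C0_00 C0_01 C0_10 C0_11 [RHS]mxE [RHS]/=; ring.
rewrite C0_10 C0_11 !(conjcM, conjcN, conjcK) [RHS]mxE [RHS]/=.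
rewrite -[RHS]aabb -[RHS]mulr1 -gg; ring.
Qed.

Lemma japanese_ge (x : int) : `|x|%N%:R <= japanese x :> R.
Proof.
have -> : `|x|%N%:R = Num.sqrt (x%:~R ^+ 2) :> R.
  by rewrite sqrtr_sqr -intr_norm -abszE.
by rewrite /japanese ler_wsqrtr// lerDr.
Qed.

End model_coin.

(** * Spectrum of the walk on and off the arcs *)

Section walk_spectrum.
Context {R : realType} (C : int -> 'M[R[i]]_2).
Context (unitC : forall x, C x \is unitarymx).
Context (p q alpha beta gamma : R) (delta M r : R).
Context (p01 : 0 < p <= 1) (q0 : 0 <= q) (hpq : p ^+ 2 + q ^+ 2 = 1).
Context (delta0 : 0 < delta) (Cdelta : forall x, delta <= normc (C x 0 0)).
Context (M0 : 0 <= M) (r01 : 0 <= r < 1).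
Context (decay : forall x j k,
  normc (C x j k - C0 p q alpha beta gamma j k) <= M * r ^+ `|x|%N).
Implicit Types z w : R[i].
Local Notation U := (walk unitC).
Local Notation g := (expi (gamma / 2)).
Local Notation rez z := (Re (z * g^*)).

Let p0 : 0 < p. Proof. by case/andP: p01. Qed.

Let a0 : p%:C * expi alpha != 0.
Proof.
apply/eqP => /(congr1 (@normc R)); rewrite normc_C0_00// normc0.
by move/eqP; rewrite gt_eqF.
Qed.

Let ab1 : normc (p%:C * expi alpha) ^+ 2 + normc (q%:C * expi beta) ^+ 2 = 1.
Proof. by rewrite normc_C0_00// normc_C0_01. Qed.

Let decay_nat (n : nat) : [/\ normc (C n 0 0 - p%:C * expi alpha) <= M * r ^+ n,
  normc (C n 0 1 - q%:C * expi beta) <= M * r ^+ n,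
  normc (C n 1 0 - - (q%:C * expi beta)^* * g ^+ 2) <= M * r ^+ n &
  normc (C n 1 1 - (p%:C * expi alpha)^* * g ^+ 2) <= M * r ^+ n].
Proof.
rewrite -(C0_10 p q alpha beta gamma) -(C0_11 p q alpha beta gamma).
rewrite -(C0_00 p q alpha beta gamma) -(C0_01 p q alpha beta gamma).
by split; exact: (decay n).
Qed.

(** On the unit circle [|Re zeta| < p] and [|Im zeta| > q] are the same condition, as
    [p ^+ 2 + q ^+ 2 = 1]. *)
Let elliptic z : normc z = 1 -> `|rez z| < p ->
  normc (q%:C * expi beta) < `|Im (z * g^*)|.
Proof.
move=> z1 zp; rewrite normc_C0_01// -(@ltr_pXn2r _ 2)// ?nnegrE//.
rewrite real_normK ?num_real//.
have : normc (z * g^*) ^+ 2 = 1 by rewrite normcM normc_conj normc_expi z1 mulr1 expr1n.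
rewrite sqr_normcE; have : `|rez z| ^+ 2 < p ^+ 2 by rewrite ltr_pXn2r// nnegrE ltW.
by rewrite real_normK ?num_real//; have := hpq; lra.
Qed.

Lemma no_eigenvalue_inside z : normc z = 1 -> `|rez z| < p -> ~ is_eigenvalue U z.
Proof.
move=> z1 zp; exact: (elliptic_no_eigenvalue (normc_expi _) z1 a0 ab1
  delta0 Cdelta M0 r01 decay_nat (elliptic z1 zp)).
Qed.

(** A resolvent point has a lower bound [c], which leaves [c / 2] at every point within [c / 2].
    Interior points of the arcs, where Weyl sequences exist, come that close even to the ends. *)
Lemma arc_spectrum z : normc z = 1 -> `|rez z| <= p -> spectrum U z.
Proof.
move=> z1 zp Rz; have [c c0 cP] := resolvent_bounded_below Rz.
have c2 : 0 < c / 2 by rewrite divr_gt0.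
have zeta1 : normc (z * g^*) = 1 by rewrite normcM normc_conj normc_expi mulr1.
have [w [w1 wp _ wz]] := unit_dense p01 zeta1 zp c2.
have wg : w * g * g^* = w by rewrite -mulrA mulc_conj normc_expi expr1n mulr1.
have wg1 : normc (w * g) = 1 by rewrite normcM normc_expi mulr1.
have wgz : normc (w * g - z) < c / 2.
  by rewrite -(expi_conjK z (gamma / 2)) -mulrBl normcM normc_expi mulr1.
have wgp : `|rez (w * g)| < p by rewrite wg.
have [psi psiP] := elliptic_not_bounded_below unitC (normc_expi _) wg1
  a0 ab1 delta0 Cdelta M0 r01 decay_nat (elliptic wg1 wgp) c2.
have := cP psi; apply/negP; rewrite -ltNge.
have -> : U psi - z *: psi = (U psi - (w * g) *: psi) + (w * g - z) *: psi.
  by rewrite scalerBl addrA subrK.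
apply: le_lt_trans (ler_l2normD _ _) _; rewrite l2normZ.
have := ler_wpM2r (l2norm_ge0 psi) (ltW wgz).
have -> : c * l2norm psi = c / 2 * l2norm psi + c / 2 * l2norm psi by field.
exact: ltr_leD.
Qed.

Lemma arc_not_isolated z : normc z = 1 -> `|rez z| <= p -> ~ isolated (spectrum U) z.
Proof.
move=> z1 zp [_ [V /nbhs_ballP[[e ei] e0 eV] VU]].
move: e0 => /=; rewrite ltcE => /andP[/eqP ei0 e0]; rewrite /= in ei0 e0.
have zeta1 : normc (z * g^*) = 1 by rewrite normcM normc_conj normc_expi mulr1.
have [w [w1 wp wz we]] := unit_dense p01 zeta1 zp e0.
have wg : w * g * g^* = w by rewrite -mulrA mulc_conj normc_expi expr1n mulr1.
have : (V `&` spectrum U) (w * g).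
  split.
    apply: eV; rewrite ei0 -ball_normE /= -[_ < _]/((normc (z - w * g))%:C < e%:C) ltcR.
    by rewrite normc_distC -(expi_conjK z (gamma / 2)) -mulrBl normcM normc_expi mulr1.
  by apply: arc_spectrum; rewrite ?wg ?ltW// normcM normc_expi mulr1.
rewrite VU /= => wgz; move/negP: wz; apply; apply/eqP.
by rewrite -wgz wg.
Qed.

Lemma decay_finite (e : R) : 0 < e -> exists2 s : seq int, uniq s &
  forall x, x \notin s -> forall j k,
    normc (C x j k - (C0 p q alpha beta gamma) j k) <= e.
Proof.
move=> e0; have [N NP] := expr_small M r01 e0.
exists (undup ([seq n%:Z | n <- iota 0 N] ++ [seq - n%:Z | n <- iota 0 N])).
  exact: undup_uniq.
move=> x xs j k; apply: le_trans (decay x j k) _; rewrite mulrC ltW// NP//.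
rewrite leqNgt; apply/negP => xN; move/negP: xs; apply.
rewrite mem_undup mem_cat; apply/orP.
have [x0|x0] := leP 0 x; [left|right]; apply/mapP; exists `|x|%N.
- by rewrite mem_iota.
- by lia.
- by rewrite mem_iota.
- by lia.
Qed.

Lemma discrete_outside z : spectrum U z -> p < `|rez z| -> discrete_spectrum U z.
Proof.
have aux (x n m : R) : (2 * x - p - p) * n <= (1 + 1) * m -> (x - p) * n <= m.
  by move=> h; lra.
move=> Uz zp; have z1 := spectrum_unit Uz.
have zn0 : z != 0.
  by apply/eqP => ze; move: z1; rewrite ze normc0 => /esym/eqP; rewrite oner_eq0.
have unitK (x : int) : (fun=> C0 p q alpha beta gamma) x \is unitarymx.
  exact: C0_unitary.
have g2z : g ^+ 2 / z = g * (z * g^*)^*.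
  rewrite (normc_eq1 z1) expr2.
  by rewrite conjcM conjcK; ring.
have zK : z = g * (z * g^*) by rewrite mulrC expi_conjK.
have tr : normc (z + g ^+ 2 / z) = 2 * `|rez z|.
  rewrite g2z {1}zK -mulrDr normcM normc_expi mul1r; move: (z * g^*) => zeta.
  have -> : zeta + zeta^* = (2 * Re zeta)%:C.
    by case: zeta => x y; rewrite /Algebra.add/=; congr Complex; ring.
  by rewrite normc_real normrM ger0_norm.
have zc : coercive_mod_finite (walk_sub unitC z).
  apply: (@walk_coercive _ _ _ unitC unitK z (`|rez z| - p)).
  - exact: decay_finite.
  - by rewrite subr_gt0.
  move=> psi; have := constant_walk_bounded_below unitK psi zn0.
  have nK0 : normc (C0 p q alpha beta gamma 0 0) = p by rewrite C0_00 normc_C0_00.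
  have nK1 : normc (C0 p q alpha beta gamma 1 1) = p.
    rewrite C0_11 normcM normc_conj normc_C0_00//.
    by rewrite expi_half_sqr normc_expi mulr1.
  have ng : normc (g ^+ 2 / z) = 1.
    by rewrite normcM normcV z1 expi_half_sqr normc_expi invr1 mulr1.
  rewrite det_C0// tr nK0 nK1 ng.
  exact: aux.
split; first exact: coercive_isolated.
  exact: coercive_eigenvalue.
apply: walk_finite_multiplicity => // x.
by apply/eqP => c0; have := Cdelta x; rewrite c0 normc0 leNgt delta0.
Qed.

End walk_spectrum.

Theorem theorem1p2 (R : realType) (C : int -> 'M[R[i]]_2)
    (unitC : forall x, C x \is unitarymx)
    (p q alpha beta gamma : R)
    (halpha : 0 <= alpha < 2 * pi) (hbeta : 0 <= beta < 2 * pi)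
    (hgamma : 0 <= gamma < 2 * pi)
    (hp : 0 < p <= 1) (hq : 0 <= q <= 1) (hpq : p ^+ 2 + q ^+ 2 = 1)
    (hedge : exists2 delta : R, 0 < delta & forall x, delta%:C <= `|C x 0 0|)
    (hdecay : exists rho M : R, [/\ 0 < rho, 0 < M &
       forall x, `|C x - C0 p q alpha beta gamma| <=
                 (M * expR (- rho * japanese x))%:C]) :
  let U := walk unitC in
  ess_spectrum U = [set expi theta | theta in J p gamma] /\
  forall z, (ess_spectrum U `\` thresholds U p gamma) z -> ~ is_eigenvalue U z.
Proof.
move=> U; have [delta delta0 Cdelta0] := hedge.
have Cdelta x : delta <= normc (C x 0 0) by rewrite -lecR; exact: Cdelta0.
have [rho [M [rho0 Mpos decay0]]] := hdecay.
have /andP[q0 _] := hq.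
pose r := expR (- rho).
have r01 : 0 <= r < 1 by rewrite expR_ge0/= expR_lt1 oppr_lt0.
have decay x j k : normc (C x j k - C0 p q alpha beta gamma j k) <= M * r ^+ `|x|%N.
  have := normc_entry_le j k (decay0 x); rewrite !mxE => /le_trans; apply.
  (* Replacing [japanese x] by the smaller [|x|] turns the decay into a geometric one of ratio
     [r = expR (- rho)]. *)
  rewrite ler_pM2l// /r -expRM_natr ler_expR !mulNr lerN2 ler_pM2l//.
  exact: japanese_ge.
have M0 := ltW Mpos.
have ess z : ess_spectrum U z -> normc z = 1 /\ `|Re (z * (expi (gamma / 2))^*)| <= p.
  move=> [Uz nd]; split; first exact: spectrum_unit Uz.
  rewrite leNgt; apply/negP => zp; apply: nd.
  exact: (discrete_outside hp q0 hpq delta0 Cdelta M0 r01 decay).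
split.
  apply/seteqP; split=> z; first by move=> /ess/arcP; exact.
  move=> /(arcP _ _ hp)[z1 zp]; split.
    exact: (arc_spectrum hp q0 hpq delta0 Cdelta M0 r01 decay).
  by move=> [/(arc_not_isolated hp q0 hpq delta0 Cdelta M0 r01 decay z1 zp)].
move=> z [Ez nT]; have [z1 zp] := ess z Ez.
apply: (no_eigenvalue_inside hp q0 hpq delta0 Cdelta M0 r01 decay z1).
rewrite lt_neqAle zp andbT; apply/eqP => zpE; apply: nT.
by split=> //; exact: threshold_arcP hp z1 zpE.
Qed.
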